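(* Let $S$ and $T$ be ultramatricial algebras over a semifield $F$. Then $(\mathcal{SV}(S), \overline{S}) \cong (\mathcal{SV}(T), \overline{T})$ (i.e. there is a monoid isomorphism $f\colon\mathcal{SV}(S)\to\mathcal{SV}(T)$ with $f(\overline{S})=\overline{T}$) if and only if $S \cong T$ as $F$-algebras.
   Context: A semiring $(S,+,\cdot,0,1)$ consists of a commutative monoid $(S,+,0)$ and a monoid $(S,\cdot,1)$ such that multiplication distributes over addition on both sides and $0s=0=s0$. A semifield is a commutative semiring $F$ with $(F\setminus\{0\},\cdot,1)$ a group. A (unital) $F$-algebra is an $F$-semimodule with an associative $F$-bilinear multiplication with identity element. A matricial $F$-algebra is an $F$-algebra isomorphic to $M_{n_1}(F)\times\cdots\times M_{n_r}(F)$ for some positive integers $n_1,\dots,n_r$. An $F$-algebra is ultramatricial if it is isomorphic to the direct limit, in the category of unital $F$-algebras, of a sequence $S_1\to S_2\to\cdots$ of matricial $F$-algebras. Right $S$-semimodules are commutative monoids with a unital, biadditive, associative right action of $S$ with $0_Ms=0_M=m0$. A finitely generated strongly projective right $S$-semimodule is one isomorphic to a direct summand of $S^n$ (as right $S$-semimodules) for some $n$. $\mathcal{SV}(S)$ is the commutative monoid of isomorphism classes $\overline{P}$ of finitely generated strongly projective right $S$-semimodules, with $\overline{P}+\overline{Q}=\overline{P\oplus Q}$ and zero element $\overline{0}$. *)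

(* Defs.v *)
From HB Require Import structures.
From mathcomp Require Import all_boot all_order all_algebra.
From mathcomp Require Import boolp.

Set Implicit Arguments.
Unset Strict Implicit.
Unset Printing Implicit Defensive.

Import GRing.Theory.

Local Open Scope ring_scope.

(* [comNzSemiRingType] already provides commutativity and [1 != 0], and closure
   of [F \ {0}] under products follows from the existence of inverses. *)
Definition semifield (F : comNzSemiRingType) : Prop :=
  forall x : F, x != 0 -> exists y : F, x * y = 1.

Section Ultramatricial.
Variable F : comNzSemiRingType.

(* Unital [F]-algebras are objects of [semiAlgType F].  That structure excludes
   the zero algebra, which is not ultramatricial: a direct limit of nonzero
   algebras along unital morphisms is nonzero. *)

Definition alg_iso (A B : semiAlgType F) : Prop :=
  exists f : {lrmorphism A -> B}, bijective f.

(* The product of the full matrix algebras of sizes [n.+1] and [m.+1], [m]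
   ranging over [s]: exactly the nonempty products of matrix algebras of
   positive size. *)
Fixpoint matrix_prod (n : nat) (s : seq nat) : semiAlgType F :=
  if s is m :: s' then ('M[F]_n.+1 * matrix_prod m s')%type else 'M[F]_n.+1.

Definition matricial (A : semiAlgType F) : Prop :=
  exists n s, alg_iso A (matrix_prod n s).

Definition cocone (A : nat -> semiAlgType F)
    (phi : forall i, {lrmorphism A i -> A i.+1})
    (B : semiAlgType F) (v : forall i, {lrmorphism A i -> B}) : Prop :=
  forall i, v i.+1 \o phi i =1 v i.

(* The universal property of direct limits.  Against the zero algebra, which is
   not in [semiAlgType F], it would hold trivially. *)
Definition direct_limit (A : nat -> semiAlgType F)
    (phi : forall i, {lrmorphism A i -> A i.+1})
    (L : semiAlgType F) (u : forall i, {lrmorphism A i -> L}) : Prop :=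
  cocone phi u /\
  forall (B : semiAlgType F) (v : forall i, {lrmorphism A i -> B}),
    cocone phi v ->
    exists2 h : {lrmorphism L -> B},
      forall i, h \o u i =1 v i &
      forall h' : {lrmorphism L -> B}, (forall i, h' \o u i =1 v i) -> h' =1 h.

Definition ultramatricial (S : semiAlgType F) : Prop :=
  exists (A : nat -> semiAlgType F)
         (phi : forall i, {lrmorphism A i -> A i.+1})
         (u : forall i, {lrmorphism A i -> S}),
    (forall i, matricial (A i)) /\ direct_limit phi u.

End Ultramatricial.

(* [SV S] below consists of isomorphism classes of semimodules, so it lives in a
   universe above that of [nmodType]; hence this separate structure. *)
Record comMonoid : Type := ComMonoid {
  cm_sort :> Type;
  cm_add : cm_sort -> cm_sort -> cm_sort;
  cm_zero : cm_sort;
  cm_addA : forall x y z, cm_add x (cm_add y z) = cm_add (cm_add x y) z;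
  cm_addC : forall x y, cm_add x y = cm_add y x;
  cm_add0 : forall x, cm_add cm_zero x = x }.

Definition com_monoid_iso (M N : comMonoid) (f : M -> N) : Prop :=
  [/\ bijective f,
      forall x y, f (cm_add x y) = cm_add (f x) (f y)
    & f (cm_zero M) = cm_zero N].

(* Right [S]-semimodules are left semimodules over the converse semiring [S^c];
   the right action of [s] on [m] is [s *: m]. *)
Section StronglyProjective.
Variable S : pzSemiRingType.

Definition mod_iso (P Q : lSemiModType S^c) : Prop :=
  exists f : {linear P -> Q}, bijective f.

Lemma mod_iso_refl P : mod_iso P P.
Proof. by exists (idfun : {linear P -> P}); exists idfun. Qed.

Lemma semilinear_mod_iso (P Q : lSemiModType S^c) (f : P -> Q) :
  semilinear f -> bijective f -> mod_iso P Q.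
Proof.
move=> fl fb.
pose fM := GRing.isSemilinear.Build _ _ _ _ f fl.
pose fL : {linear P -> Q} := HB.pack f fM.
by exists fL.
Qed.

Lemma mod_iso_sym P Q : mod_iso P Q -> mod_iso Q P.
Proof.
case=> f [g fK gK]; apply: (@semilinear_mod_iso _ _ g); last by exists f.
by split=> [a x|x y]; apply: (can_inj fK); rewrite ?linearZ ?raddfD /= !gK.
Qed.

Lemma mod_iso_trans P Q M : mod_iso P Q -> mod_iso Q M -> mod_iso P M.
Proof.
case=> f fb [g gb]; exists (g \o f : {linear P -> M}).
exact: bij_comp.
Qed.

Lemma mod_iso_prod P P' Q Q' :
  mod_iso P P' -> mod_iso Q Q' -> mod_iso (P * Q)%type (P' * Q')%type.
Proof.
case=> f [f' fK f'K] [g [g' gK g'K]].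
apply: (@semilinear_mod_iso _ _ (fun x => (f x.1, g x.2))).
  by split=> [a [x y]|[x y] [z t]] /=; rewrite ?linearZ ?raddfD.
by exists (fun x => (f' x.1, g' x.2)) => [[x y]|[x y]] /=; rewrite ?fK ?gK ?f'K ?g'K.
Qed.

Lemma mod_iso_prodC (P Q : lSemiModType S^c) :
  mod_iso (P * Q)%type (Q * P)%type.
Proof.
apply: (@semilinear_mod_iso _ _ (fun x => (x.2, x.1))) => //.
by exists (fun x => (x.2, x.1)) => [[x y]|[x y]].
Qed.

Lemma mod_iso_prodA (P Q M : lSemiModType S^c) :
  mod_iso (P * (Q * M))%type (P * Q * M)%type.
Proof.
apply: (@semilinear_mod_iso _ _ (fun x => ((x.1, x.2.1), x.2.2))) => //.
by exists (fun x => (x.1.1, (x.1.2, x.2))) => [[x [y z]]|[[x y] z]].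
Qed.

Lemma mod_iso_prod0 (P : lSemiModType S^c) :
  mod_iso ('rV[S^c]_0 * P)%type P.
Proof.
apply: (@semilinear_mod_iso _ _ (fun x => x.2)) => //.
by exists (fun x => (0, x)) => [[x y]|x] //=; rewrite [x]thinmx0.
Qed.

Lemma mod_iso_row_mx n m :
  mod_iso ('rV[S^c]_n * 'rV[S^c]_m)%type 'rV[S^c]_(n + m).
Proof.
apply: (@semilinear_mod_iso _ _ (fun x => row_mx x.1 x.2)).
  by split=> [a [x y]|[x y] [z t]] /=; rewrite ?scale_row_mx ?add_row_mx.
exists (fun x => (lsubmx x, rsubmx x)) => [[x y]|x] /=.
  by rewrite row_mxKl row_mxKr.
exact: hsubmxK.
Qed.

Lemma mod_iso_regular : mod_iso (S^c)^o 'rV[S^c]_1.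
Proof.
apply: (@semilinear_mod_iso (S^c)^o 'rV[S^c]_1 (fun x => const_mx x)).
  by split=> [a x|x y]; apply/matrixP=> i j; rewrite !mxE.
exists (fun x : 'rV[S^c]_1 => x ord0 ord0) => [x|x]; first by rewrite mxE.
by apply/rowP=> j; rewrite mxE (ord1 j).
Qed.

(* Being isomorphic to a direct summand of [S^n]. *)
Definition fg_strongly_projective (P : lSemiModType S^c) : Prop :=
  exists (n : nat) (Q : lSemiModType S^c), mod_iso (P * Q)%type 'rV[S^c]_n.

Record fgsp : Type := Fgsp {
  fgsp_sort :> lSemiModType S^c;
  fgspP : fg_strongly_projective fgsp_sort }.

Lemma fgsp_zero_subproof : fg_strongly_projective 'rV[S^c]_0.
Proof. by exists 0, 'rV[S^c]_0; apply: mod_iso_prod0. Qed.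

Definition fgsp_zero : fgsp := Fgsp fgsp_zero_subproof.

Lemma fgsp_regular_subproof : fg_strongly_projective (S^c)^o.
Proof.
exists 1, 'rV[S^c]_0; apply: mod_iso_trans (mod_iso_prodC _ _) _.
exact: mod_iso_trans (mod_iso_prod0 _) mod_iso_regular.
Qed.

Definition fgsp_regular : fgsp := Fgsp fgsp_regular_subproof.

Lemma fgsp_sum_subproof (P Q : fgsp) : fg_strongly_projective (P * Q)%type.
Proof.
have [n [P' isoP]] := fgspP P; have [m [Q' isoQ]] := fgspP Q.
exists (n + m), (P' * Q')%type.
apply: mod_iso_trans _ (mod_iso_row_mx n m).
apply: mod_iso_trans _ (mod_iso_prod isoP isoQ).
apply: mod_iso_trans (mod_iso_sym (mod_iso_prodA _ _ _)) _.
apply: mod_iso_trans _ (mod_iso_prodA _ _ _).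
apply: mod_iso_prod (mod_iso_refl _) _.
apply: mod_iso_trans (mod_iso_prodA _ _ _) _.
apply: mod_iso_trans _ (mod_iso_sym (mod_iso_prodA _ _ _)).
exact: mod_iso_prod (mod_iso_prodC _ _) (mod_iso_refl _).
Qed.

Definition fgsp_sum (P Q : fgsp) : fgsp := Fgsp (fgsp_sum_subproof P Q).

(* Isomorphism classes, as predicates on all finitely generated strongly
   projective right [S]-semimodules. *)
Record SV_sort : Type := SVSort {
  SV_pred : fgsp -> Prop;
  SV_predP : exists P : fgsp, SV_pred = mod_iso P }.

Definition SV_class (P : fgsp) : SV_sort :=
  @SVSort (mod_iso P) (ex_intro _ P erefl).

Lemma SV_sort_eq (x y : SV_sort) : SV_pred x = SV_pred y -> x = y.
Proof.
case: x y => [p pP] [q qP] /= pq; move: pP qP; rewrite pq => pP qP.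
by rewrite (Prop_irrelevance pP qP).
Qed.

Lemma SV_classP (P Q : fgsp) : SV_class P = SV_class Q <-> mod_iso P Q.
Proof.
split=> [/(congr1 (fun x => SV_pred x Q)) /= ->|PQ]; first exact: mod_iso_refl.
apply: SV_sort_eq; apply: funext => M /=; apply: propext.
by split; apply: mod_iso_trans; [apply: mod_iso_sym|].
Qed.

Lemma SV_classE (x : SV_sort) : exists P, x = SV_class P.
Proof. by case: (SV_predP x) => P xP; exists P; apply: SV_sort_eq. Qed.

Definition SV_add_pred (x y : SV_sort) : fgsp -> Prop := fun M =>
  exists P Q : fgsp, [/\ SV_pred x P, SV_pred y Q & mod_iso (P * Q)%type M].

Lemma SV_add_predE (P Q : fgsp) :
  SV_add_pred (SV_class P) (SV_class Q) = mod_iso (fgsp_sum P Q).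
Proof.
apply: funext => M; apply: propext; split=> [[P' [Q' [PP' QQ' iM]]]|iM].
  exact: mod_iso_trans (mod_iso_prod PP' QQ') iM.
by exists P, Q; split=> //; apply: mod_iso_refl.
Qed.

Lemma SV_add_subproof (x y : SV_sort) :
  exists P : fgsp, SV_add_pred x y = mod_iso P.
Proof.
have [P ->] := SV_classE x; have [Q ->] := SV_classE y.
by exists (fgsp_sum P Q); apply: SV_add_predE.
Qed.

Definition SV_add (x y : SV_sort) : SV_sort := SVSort (SV_add_subproof x y).

Lemma SV_addE (P Q : fgsp) :
  SV_add (SV_class P) (SV_class Q) = SV_class (fgsp_sum P Q).
Proof. by apply: SV_sort_eq; apply: SV_add_predE. Qed.

Lemma SV_addA (x y z : SV_sort) : SV_add x (SV_add y z) = SV_add (SV_add x y) z.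
Proof.
have [P ->] := SV_classE x; have [Q ->] := SV_classE y.
have [M ->] := SV_classE z; rewrite !SV_addE.
exact/SV_classP/mod_iso_prodA.
Qed.

Lemma SV_addC (x y : SV_sort) : SV_add x y = SV_add y x.
Proof.
have [P ->] := SV_classE x; have [Q ->] := SV_classE y; rewrite !SV_addE.
exact/SV_classP/mod_iso_prodC.
Qed.

Lemma SV_add0 (x : SV_sort) : SV_add (SV_class fgsp_zero) x = x.
Proof.
have [P ->] := SV_classE x; rewrite SV_addE.
exact/SV_classP/mod_iso_prod0.
Qed.

Definition SV : comMonoid := ComMonoid SV_addA SV_addC SV_add0.

End StronglyProjective.

Definition SV_pointed_iso (S T : pzSemiRingType) : Prop :=
  exists2 f : SV S -> SV T, com_monoid_iso f &
    f (SV_class (fgsp_regular S)) = SV_class (fgsp_regular T).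

(* Main.v *)
Require Import Defs.
From HB Require Import structures.
From mathcomp Require Import all_boot all_order all_algebra.
From mathcomp Require Import generic_quotient boolp.

(* Elliott's argument, carried out on elements rather than on modules.  A right
   ideal [gS] generated by a complemented idempotent determines a class in
   [SV S]; two such classes agree iff [g = x y] and [h = y x] for some [x], [y],
   and a decomposition of the class of [g] in [SV S] is realised by a
   decomposition of [g] into orthogonal idempotents.  Hence an isomorphism of
   pointed monoids carries a system of matrix units of [S] to one of [T], and two
   systems whose diagonal idempotents have the same classes are conjugate by a
   unit.

   Over a semifield a complemented idempotent matrix factors as [X Y] with
   [Y X = 1]: over a field this is the rank factorisation, and a semifield that
   is not a field has no nontrivial sums equal to [0], so that such a matrix is
   diagonal with entries [0] and [1].  Idempotents in the span of a system of
   matrix units therefore decompose into diagonal units, and their classes are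
   determined by those of the diagonal units.

   An ultramatricial algebra is the increasing union of the spans of systems of
   matrix units, and a back-and-forth construction along two such unions gives an
   increasing chain of partial isomorphisms whose union is an isomorphism. *)

Set Implicit Arguments.
Unset Strict Implicit.
Unset Printing Implicit Defensive.

Import GRing.Theory.
Local Open Scope ring_scope.

(** * Classes of idempotents *)

Section IdempotentClass.
Variable S : pzSemiRingType.
Implicit Types (g h x y : S) (P Q : lSemiModType S^c).

(* [P] is isomorphic to [gS]: [p] is the image of [g], and [rho] is the
   embedding of [P] into [S]. *)
Definition represents g P : Prop :=
  exists (p : P) (rho : P -> S),
    [/\ forall z t, rho (z + t) = rho z + rho t,
        forall (a : S) z, rho ((a : S^c) *: z) = rho z * a,
        rho p = g & forall z, (rho z : S^c) *: p = z].

(** This is a relation, not a function: an idempotent without a complement is not assigned a class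
    in advance. *)
Definition idem_class g (a : SV S) : Prop :=
  exists2 P : fgsp S, a = SV_class P & represents g P.

Lemma scaler_converse P (a b : S) (z : P) :
  (b : S^c) *: ((a : S^c) *: z) = ((a * b : S) : S^c) *: z.
Proof. by rewrite scalerA. Qed.

Lemma linear_morph0 P (rho : P -> S) :
  (forall (a : S) z, rho ((a : S^c) *: z) = rho z * a) -> rho 0 = 0.
Proof. by move=> rZ; have := rZ 0 0; rewrite scaler0 mulr0. Qed.

Lemma represents_idem g P : represents g P -> g * g = g.
Proof. by case=> p [rho [rD rZ <- rK]]; rewrite -rZ rK. Qed.

Lemma represents_iso g P Q : mod_iso P Q -> represents g P -> represents g Q.
Proof.
case=> f [f' fK f'K] [p [rho [rD rZ rp rK]]].
exists (f p), (rho \o f'); split=> [z t|a z||z].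
- by rewrite -rD; congr rho; apply: (can_inj fK); rewrite raddfD /= !f'K.
- by rewrite -[RHS]rZ; congr rho; apply: (can_inj fK); rewrite linearZ /= !f'K.
- by rewrite /= fK.
- by rewrite /= -linearZ rK f'K.
Qed.

Lemma represents_mod_iso g P Q : represents g P -> represents g Q -> mod_iso P Q.
Proof.
case=> p [rho [rD rZ rp rK]] [q [tau [tD tZ tq tK]]].
have gp : (g : S^c) *: p = p by rewrite -rp rK.
have gq : (g : S^c) *: q = q by rewrite -tq tK.
apply: (@semilinear_mod_iso _ _ _ (fun z => (rho z : S^c) *: q)).
  split=> [a z|z t]; first by rewrite rZ scaler_converse.
  by rewrite rD scalerDl.
exists (fun z => (tau z : S^c) *: p) => z.
  by rewrite tZ -scaler_converse tq gp rK.
by rewrite rZ -scaler_converse rp gq tK.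
Qed.

(** Each embedding is evaluated at the generator of the other: with [x = rho q] and [y = tau p], the
    product [x * y] is [rho] of [q] acted on by [tau p], which is [rho p = g]. *)
Lemma represents_equiv g h P : represents g P -> represents h P ->
  exists x y, [/\ x * y = g, y * x = h, g * x = x & h * y = y].
Proof.
case=> p [rho [rD rZ rp rK]] [q [tau [tD tZ tq tK]]].
exists (rho q), (tau p).
by rewrite -!rZ -!tZ !tK !rK rp tq -rp -tq -rZ -tZ rK tK.
Qed.

(** Left multiplication by [y] carries [gS] onto [hS]; the new generator is [p] acted on by [x]. *)
Lemma equiv_represents g h x y P :
  x * y = g -> y * x = h -> g * x = x -> represents g P -> represents h P.
Proof.
move=> xy yx gx [p [rho [rD rZ rp rK]]].
exists ((x : S^c) *: p), (fun z => y * rho z); split=> [z t|a z||z].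
- by rewrite rD mulrDr.
- by rewrite rZ mulrA.
- by rewrite rZ rp gx.
- by rewrite scaler_converse mulrA xy -rp -rZ !rK.
Qed.

Lemma represents_sum g h P Q : g * h = 0 -> h * g = 0 ->
  represents g P -> represents h Q -> represents (g + h) (P * Q)%type.
Proof.
move=> gh hg [p [rho [rD rZ rp rK]]] [q [tau [tD tZ tq tK]]].
exists (p, q), (fun z => rho z.1 + tau z.2); split=> [z t|a z||z] /=.
- by rewrite rD tD addrACA.
- by rewrite rZ tZ mulrDl.
- by rewrite rp tq.
have gp : (g : S^c) *: p = p by rewrite -rp rK.
have hq : (h : S^c) *: q = q by rewrite -tq tK.
(* By orthogonality each idempotent kills the generator of the other summand, so [(p, q)] generates
   the whole sum. *)
have hp : (h : S^c) *: p = 0 by rewrite -gp scaler_converse gh scale0r.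
have gq : (g : S^c) *: q = 0 by rewrite -hq scaler_converse hg scale0r.
have gr t : rho t = g * rho t by rewrite -rp -rZ rK.
have hr t : tau t = h * tau t by rewrite -tq -tZ tK.
case: z => z t /=; congr (_, _) => /=; rewrite scalerDl.
  by rewrite rK hr -scaler_converse hp scaler0 addr0.
by rewrite tK gr -scaler_converse gq scaler0 add0r.
Qed.

(** The generator of the sum is a pair [(p, q)]; the embedding sends [(p, 0)] and [(0, q)] to the
    two orthogonal parts of [g]. *)
Lemma represents_split g P Q : represents g (P * Q)%type ->
  exists g1 g2, [/\ g = g1 + g2, g1 * g2 = 0, g2 * g1 = 0,
    represents g1 P & represents g2 Q].
Proof.
case=> [[p q] [rho [rD rZ rp rK]]].
have r0 := linear_morph0 rZ.
exists (rho (p, 0)), (rho (0, q)).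
have E1 z : (rho (z, 0) : S^c) *: (p, q) = (z, 0) by rewrite rK.
have E2 z : (rho (0, z) : S^c) *: (p, q) = (0, z) by rewrite rK.
have [p1 p2] : (forall z, (rho (z, 0) : S^c) *: p = z) /\
               (forall z, (rho (z, 0) : S^c) *: q = 0).
  by split=> z; have := E1 z; case.
have [q1 q2] : (forall z, (rho (0, z) : S^c) *: q = z) /\
               (forall z, (rho (0, z) : S^c) *: p = 0).
  by split=> z; have := E2 z; case.
have X1 (a : S) z : (a : S^c) *: ((z, 0) : P * Q) = ((a : S^c) *: z, 0).
  by congr (_, _); apply: scaler0.
have X2 (a : S) z : (a : S^c) *: ((0, z) : P * Q) = (0, (a : S^c) *: z).
  by congr (_, _); apply: scaler0.
split.
- by rewrite -rD -rp; congr rho; congr (_, _); rewrite /= ?addr0 ?add0r.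
- by rewrite -rZ X1 q2 r0.
- by rewrite -rZ X2 p2 r0.
- exists p, (fun z => rho (z, 0)); split=> // [z t|a z].
    by rewrite -rD; congr rho; congr (_, _); rewrite /= addr0.
  by rewrite -rZ X1.
- exists q, (fun z => rho (0, z)); split=> // [z t|a z].
    by rewrite -rD; congr rho; congr (_, _); rewrite /= addr0.
  by rewrite -rZ X2.
Qed.

Lemma idem_class_idem g a : idem_class g a -> g * g = g.
Proof. by case=> P _ /represents_idem. Qed.

Lemma idem_class_uniq g a b : idem_class g a -> idem_class g b -> a = b.
Proof.
case=> P -> gP [Q -> gQ]; apply/SV_classP; exact: represents_mod_iso gP gQ.
Qed.

Lemma idem_class_equiv g h a : idem_class g a -> idem_class h a ->
  exists x y, [/\ x * y = g, y * x = h, g * x = x & h * y = y].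
Proof.
case=> P -> gP [Q /SV_classP PQ hQ].
exact: represents_equiv gP (represents_iso (mod_iso_sym PQ) hQ).
Qed.

Lemma equiv_idem_class g h x y a :
  x * y = g -> y * x = h -> g * x = x -> idem_class g a -> idem_class h a.
Proof.
by move=> xy yx gx [P -> gP]; exists P => //; apply: (equiv_represents xy yx gx).
Qed.

Lemma idem_class_sum g h a b : g * h = 0 -> h * g = 0 ->
  idem_class g a -> idem_class h b -> idem_class (g + h) (cm_add a b).
Proof.
move=> gh hg [P -> gP] [Q -> hQ]; exists (fgsp_sum P Q); first exact: SV_addE.
exact: represents_sum.
Qed.

Lemma idem_class_split g (a b : SV S) : idem_class g (cm_add a b) ->
  exists g1 g2, [/\ g = g1 + g2, g1 * g2 = 0, g2 * g1 = 0,
    idem_class g1 a & idem_class g2 b].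
Proof.
have [P ->] := SV_classE a; have [Q ->] := SV_classE b.
case=> M; rewrite /= SV_addE => /SV_classP PQM gM.
have [g1 [g2 [gE g12 g21 g1P g2Q]]] :=
  represents_split (represents_iso (mod_iso_sym PQM) gM).
by exists g1, g2; split=> //; [exists P | exists Q].
Qed.

Lemma idem_class1 : idem_class 1 (SV_class (fgsp_regular S)).
Proof.
exists (fgsp_regular S) => //; exists (1 : S), id; split=> // z.
exact: (@mul1r S).
Qed.

Lemma idem_class0 : idem_class 0 (cm_zero (SV S)).
Proof.
exists (fgsp_zero S) => //; exists 0, (fun=> 0); split=> // [z t|a z|z].
- by rewrite addr0.
- by rewrite mul0r.
- by rewrite [RHS]thinmx0 scaler0.
Qed.

Lemma idem_class_zero g : idem_class g (cm_zero (SV S)) -> g = 0.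
Proof.
move=> g0; have [x [y [<- yx gx hy]]] := idem_class_equiv g0 idem_class0.
by rewrite -hy mul0r mulr0.
Qed.

End IdempotentClass.

(** * The right ideal generated by an idempotent, as a semimodule *)

Section IdempotentModule.
Variables (S : pzSemiRingType) (g : S).

(** For idempotent [g] the solutions of [g z = z] are exactly [gS]. *)
Definition idem_pred : {pred (S^c)^o} := fun z => g * (z : S) == z.

Lemma idem_pred_closed : subsemimod_closed idem_pred.
Proof.
split; first split.
- by apply/eqP; rewrite mulr0.
- by move=> x y /eqP xP /eqP yP; apply/eqP; rewrite mulrDr xP yP.
- by move=> a x /eqP xP; apply/eqP; rewrite [LHS](@mulrA S) xP.
Qed.

HB.instance Definition _ :=
  GRing.isSubSemiModClosed.Build _ _ idem_pred idem_pred_closed.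

Definition idem_mod : Type := {z : (S^c)^o | idem_pred z}.

HB.instance Definition _ := SubType.on idem_mod.
HB.instance Definition _ := [Choice of idem_mod by <:].
HB.instance Definition _ := [SubChoice_isSubLSemiModule of idem_mod by <:].

End IdempotentModule.

(** The complement gives [S = gS + hS] as a direct sum: [x] goes to [(g x, h x)], and addition is
    the inverse map. Thus [gS] is a direct summand of [S^1]. *)
Lemma idem_class_exists (S : pzSemiRingType) (g h : S) :
  g + h = 1 -> g * h = 0 -> h * g = 0 -> exists a, idem_class g a.
Proof.
move=> gh1 gh hg.
have gg : g * g = g by rewrite -[RHS]mulr1 -gh1 mulrDr gh addr0.
have hh : h * h = h by rewrite -[RHS]mulr1 -gh1 mulrDr hg add0r.
have in_mod k : k * k = k -> forall x : S, idem_pred k (k * x).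
  by move=> kk x; apply/eqP; rewrite mulrA kk.
have idE (k : S) (z : idem_mod k) : k * val z = val z by apply/eqP; exact: valP z.
pose toG x : idem_mod g := Sub (g * x) (in_mod g gg x).
pose toH x : idem_mod h := Sub (h * x) (in_mod h hh x).
have proj : fg_strongly_projective (idem_mod g).
  exists 1, (idem_mod h).
  apply: mod_iso_trans _ (mod_iso_regular S).
  apply: (@semilinear_mod_iso _ (idem_mod g * idem_mod h)%type (S^c)^o
    (fun z => (val z.1 : (S^c)^o) + val z.2)).
    split=> [a z|z t] /=; first by rewrite scalerDr.
    by rewrite addrACA.
  exists (fun x => (toG x, toH x)) => [[z t]|x] /=.
    congr (_, _); apply: val_inj => /=; rewrite mulrDr.
      by rewrite idE -[val t]idE mulrA gh mul0r addr0.
    by rewrite idE -[val z]idE mulrA hg mul0r add0r.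
  by apply: etrans (esym (mulrDl g h x)) _; rewrite gh1 mul1r.
exists (SV_class (Fgsp proj)); exists (Fgsp proj) => //.
exists (toG 1), (fun z => val z); split=> [z t|a z||z] /=.
- by [].
- by [].
- by rewrite mulr1.
by apply: val_inj; rewrite /= mulr1 [LHS]idE.
Qed.

(** * Systems of matrix units *)

Section MatrixUnits.
Variable F : comNzSemiRingType.
Variables (I : finType) (c : I -> I).

Definition comb (S : semiAlgType F) (e : I -> I -> S) (l : I -> I -> F) : S :=
  \sum_p \sum_q l p q *: e p q.

(* [c] sends an index to a representative of its block, so that the [e p q] with
   [c p == c q] are the matrix units of a product of matrix algebras. *)
Definition mxunits (S : semiAlgType F) (e : I -> I -> S) : Prop :=
  [/\ forall p q q' t,
        e p q * e q' t = if (q == q') && (c p == c q) then e p t else 0,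
      \sum_p e p p = 1 & forall p, e p p != 0].

(** Torsion-freeness stated without subtraction. It makes the coefficients of a combination of
    matrix units unique inside the blocks. *)
Definition torsion_free (S : semiAlgType F) : Prop :=
  forall (l m : F) (x : S), l *: x = m *: x -> l = m \/ x = 0.

Section One.
Variables (S : semiAlgType F) (e : I -> I -> S).

Lemma combD l m : comb e l + comb e m = comb e (fun p q => l p q + m p q).
Proof.
rewrite /comb -big_split; apply: eq_bigr => p _; rewrite -big_split.
by apply: eq_bigr => q _; rewrite scalerDl.
Qed.

Lemma combZ k l : k *: comb e l = comb e (fun p q => k * l p q).
Proof.
rewrite /comb scaler_sumr; apply: eq_bigr => p _; rewrite scaler_sumr.
by apply: eq_bigr => q _; rewrite scalerA.
Qed.

Lemma comb_sum (J : Type) (s : seq J) (P : pred J) (l : J -> I -> I -> F) :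
  \sum_(j <- s | P j) comb e (l j) =
  comb e (fun p q => \sum_(j <- s | P j) l j p q).
Proof.
rewrite /comb exchange_big; apply: eq_bigr => p _.
by rewrite exchange_big; apply: eq_bigr => q _; rewrite scaler_suml.
Qed.

Hypothesis eU : mxunits e.

Let eM : forall p q q' t,
  e p q * e q' t = if (q == q') && (c p == c q) then e p t else 0.
Proof. by case: eU. Qed.

Let e_neq0 : forall p, e p p != 0.
Proof. by case: eU. Qed.

Let sum_e : \sum_p e p p = 1.
Proof. by case: eU. Qed.

(** The product rule kills [e p q * e t t] for every [t], and the [e t t] sum to [1]. *)
Lemma mxunits_off p q : c p != c q -> e p q = 0.
Proof.
move=> /negbTE pq; rewrite -[e p q]mulr1 -sum_e mulr_sumr big1 // => t _.
by rewrite eM pq andbF.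
Qed.

Lemma mxunits_neq0 p q : c p = c q -> e p q != 0.
Proof.
move=> pq; apply/eqP => pq0; have := e_neq0 p.
have <- : e p q * e q p = e p p by rewrite eM pq !eqxx.
by rewrite pq0 mul0r eqxx.
Qed.

Lemma comb_block l : comb e l = comb e (fun p q => if c p == c q then l p q else 0).
Proof.
apply: eq_bigr => p _; apply: eq_bigr => q _.
by case: eqP => // /eqP/mxunits_off ->; rewrite !scaler0.
Qed.

Lemma comb1 : comb e (fun p q => (p == q)%:R) = 1.
Proof.
rewrite -sum_e; apply: eq_bigr => p _; rewrite (bigD1 p) //= eqxx scale1r.
by rewrite big1 ?addr0 // => q /negbTE; rewrite eq_sym => ->; rewrite scale0r.
Qed.

Lemma mulr_comb p q l :
  e p q * comb e l = if c p == c q then \sum_t l q t *: e p t else 0.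
Proof.
rewrite /comb mulr_sumr (bigD1 q) //= [X in _ + X]big1 ?addr0.
  rewrite mulr_sumr; case: ifP => pq.
    by apply: eq_bigr => t _; rewrite -scalerAr eM eqxx pq.
  by rewrite big1 // => t _; rewrite -scalerAr eM eqxx pq scaler0.
move=> q' /negbTE; rewrite eq_sym => nq; rewrite mulr_sumr big1 // => t _.
by rewrite -scalerAr eM nq scaler0.
Qed.

Lemma combM l m :
  comb e l * comb e m =
  comb e (fun p t => \sum_(q | c p == c q) l p q * m q t).
Proof.
rewrite {1}/comb mulr_suml; apply: eq_bigr => p _; rewrite mulr_suml.
transitivity (\sum_(q | c p == c q) \sum_t l p q * m q t *: e p t).
  rewrite [RHS]big_mkcond; apply: eq_bigr => q _.
  rewrite -scalerAl mulr_comb; case: ifP => _; last by rewrite scaler0.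
  by rewrite scaler_sumr; apply: eq_bigr => t _; rewrite scalerA.
rewrite exchange_big; apply: eq_bigr => t _.
by rewrite scaler_suml.
Qed.

Lemma comb_coef p q l : e p p * comb e l * e q q = l p q *: e p q.
Proof.
rewrite mulr_comb eqxx mulr_suml (bigD1 q) //= big1 => [|t /negbTE nt].
  rewrite addr0 -scalerAl eM eqxx; case: eqP => // /eqP/mxunits_off ->.
  by rewrite scaler0.
by rewrite -scalerAl eM nt scaler0.
Qed.

(** Compressing by [e p p] and [e q q] isolates the term of index [p q], and its unit is nonzero
    within a block. *)
Lemma comb_inj : torsion_free S -> forall l m, comb e l = comb e m ->
  forall p q, c p = c q -> l p q = m p q.
Proof.
move=> tf l m lm p q pq.
have /tf [] // : l p q *: e p q = m p q *: e p q by rewrite -!comb_coef lm.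
by move/eqP; rewrite (negbTE (mxunits_neq0 pq)).
Qed.

Lemma mxunits_compl p :
  [/\ e p p + \sum_(q | q != p) e q q = 1,
      e p p * (\sum_(q | q != p) e q q) = 0 &
      (\sum_(q | q != p) e q q) * e p p = 0].
Proof.
split; first by rewrite -sum_e [RHS](bigD1 p).
  by rewrite mulr_sumr big1 // => q /negbTE; rewrite eM eq_sym => ->.
by rewrite mulr_suml big1 // => q /negbTE; rewrite eM => ->.
Qed.

Lemma mxunits_class p : exists x, idem_class (e p p) x.
Proof. by have [A B C] := mxunits_compl p; apply: idem_class_exists A B C. Qed.

Lemma mxunits_class_block p q x :
  c p = c q -> idem_class (e p p) x -> idem_class (e q q) x.
Proof.
by move=> pq; apply: (@equiv_idem_class _ _ _ (e p q) (e q p));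
  rewrite eM ?pq !eqxx.
Qed.

Lemma mxunits_conj u v : u * v = 1 -> v * u = 1 ->
  mxunits (fun p q => u * e p q * v).
Proof.
move=> uv vu; split=> [p q q' t||p].
- rewrite -!mulrA (mulrA v) vu mul1r (mulrA (e p q)) eM.
  by case: ifP; rewrite ?mul0r ?mulr0.
- by rewrite -mulr_suml -mulr_sumr sum_e mulr1.
apply/eqP => /(congr1 (fun z => v * z * u)).
rewrite !mulrA vu mul1r -mulrA vu mulr1 mulr0 mul0r.
by apply/eqP.
Qed.

End One.

(** The partial isomorphism between two spans that matches [e p q] with [a p q]. It is kept as a
    relation because coefficients outside the blocks are not determined by the element. *)
Definition graph (S T : semiAlgType F) (e : I -> I -> S) (a : I -> I -> T)
  (s : S) (t : T) : Prop := exists2 l, s = comb e l & t = comb a l.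

Section Graph.
Variables (S T : semiAlgType F) (e : I -> I -> S) (a : I -> I -> T).

Lemma graph_sym s t : graph e a s t -> graph a e t s.
Proof. by case=> l -> ->; exists l. Qed.

Lemma graphD s t s' t' : graph e a s t -> graph e a s' t' ->
  graph e a (s + s') (t + t').
Proof.
by case=> l -> -> [m -> ->]; exists (fun p q => l p q + m p q); rewrite combD.
Qed.

Lemma graphZ k s t : graph e a s t -> graph e a (k *: s) (k *: t).
Proof.
by case=> l -> ->; exists (fun p q => k * l p q); rewrite combZ.
Qed.

Lemma graph0 : graph e a 0 0.
Proof.
by exists (fun p q => 0); rewrite /comb big1 // => p _;
  rewrite big1 // => q _; rewrite scale0r.
Qed.

Lemma graph_sum (J : Type) (r : seq J) (P : pred J) s t :
  (forall j, graph e a (s j) (t j)) ->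
  graph e a (\sum_(j <- r | P j) s j) (\sum_(j <- r | P j) t j).
Proof.
move=> st; elim/big_ind2: _ => // [|s1 t1 s2 t2 h1 h2]; first exact: graph0.
exact: graphD.
Qed.

Hypotheses (eU : mxunits e) (aU : mxunits a).

Lemma graph1 : graph e a 1 1.
Proof. by exists (fun p q => (p == q)%:R); rewrite comb1. Qed.

Lemma graphM s t s' t' : graph e a s t -> graph e a s' t' ->
  graph e a (s * s') (t * t').
Proof.
case=> l -> -> [m -> ->]; rewrite !combM //.
by exists (fun p t => \sum_(q | c p == c q) l p q * m q t).
Qed.

Lemma graph_fun : torsion_free S -> forall s t t',
  graph e a s t -> graph e a s t' -> t = t'.
Proof.
move=> tf s t t' [l -> ->] [m lm ->].
(* The two coefficient families may differ outside the blocks, where the units of [a] vanish. *)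
rewrite [LHS](comb_block aU) [RHS](comb_block aU).
apply: eq_bigr => p _; apply: eq_bigr => q _.
by case: eqP => // /(comb_inj eU tf lm) ->.
Qed.

End Graph.

(** The two sums are the mutually inverse intertwiners of the next lemma. The statement is symmetric
    in the two systems, so exchanging them yields the product in the other order. *)
Lemma mxunits_intertwine (S : semiAlgType F) (e a : I -> I -> S) (X Y : I -> S) :
    (forall p, c (c p) = c p) -> mxunits e -> mxunits a ->
    (forall p, X p * a p p * Y p = e p p) ->
  (\sum_p e p (c p) * X (c p) * a (c p) p) *
    (\sum_p a p (c p) * Y (c p) * e (c p) p) = 1.
Proof.
move=> cK [eM se _] [aM _ _] XaY; rewrite mulr_suml -[RHS]se.
apply: eq_bigr => p _; rewrite mulr_sumr (bigD1 p) //= big1 ?addr0.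
  rewrite -!mulrA (mulrA (a (c p) p)) aM eqxx cK eqxx /=.
  by rewrite (mulrA (X _)) (mulrA (X _ * _)) XaY eM !eqxx /= eM cK !eqxx.
move=> q /negbTE; rewrite eq_sym => nq.
by rewrite -!mulrA (mulrA (a (c p) p)) aM nq mul0r !mulr0.
Qed.

(** An equivalence is chosen between diagonal units at the representative [c p], and the units of
    both systems spread it over the block: from [p] to [c p] inside one system, across, and back to
    [p] inside the other. *)
Lemma mxunits_unique (S : semiAlgType F) (e a : I -> I -> S) :
    (forall p, c (c p) = c p) ->
    mxunits e -> mxunits a ->
    (forall p, exists2 x, idem_class (e p p) x & idem_class (a p p) x) ->
  exists u v, [/\ u * v = 1, v * u = 1 & forall p q, e p q = u * a p q * v].
Proof.
move=> cK /[dup] eU [eM se _] /[dup] aU [aM sa _] ea.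
have /choice [X /choice [Y XY]] : forall p, exists x y,
    [/\ x * y = e p p, y * x = a p p, e p p * x = x & a p p * y = y].
  by move=> p; have [x ex ax] := ea p; exact: idem_class_equiv ex ax.
have Xa p : X p * a p p * Y p = e p p.
  by have [xy <- ex _] := XY p; rewrite mulrA xy ex xy.
have Ye p : Y p * e p p * X p = a p p.
  by have [<- yx _ ay] := XY p; rewrite mulrA yx ay yx.
pose u := \sum_p e p (c p) * X (c p) * a (c p) p.
pose v := \sum_p a p (c p) * Y (c p) * e (c p) p.
have uE p : u * a p p = e p (c p) * X (c p) * a (c p) p.
  rewrite /u mulr_suml (bigD1 p) //= big1 ?addr0 => [|q /negbTE nq].
    by rewrite -!mulrA aM eqxx cK eqxx.
  by rewrite -!mulrA aM nq !mulr0.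
have vE p : a p p * v = a p (c p) * Y (c p) * e (c p) p.
  rewrite /v mulr_sumr (bigD1 p) //= big1 ?addr0 => [|q /negbTE nq].
    by rewrite !mulrA aM !eqxx.
  by rewrite !mulrA aM eq_sym nq !mul0r.
exists u, v; split.
- exact: mxunits_intertwine.
- exact: mxunits_intertwine.
move=> p q; have [pq|npq] := eqVneq (c p) (c q); last first.
  by rewrite (mxunits_off eU npq) (mxunits_off aU npq) mulr0 mul0r.
have -> : a p q = a p p * a p q * a q q by rewrite aM !eqxx aM pq !eqxx.
rewrite !mulrA uE -(mulrA _ _ v) vE -!mulrA.
rewrite (mulrA (a (c p) p)) aM eqxx cK eqxx /= (mulrA (a (c p) q)) aM eqxx /=.
rewrite cK -pq eqxx (mulrA (X _)) (mulrA (X _ * _)) Xa eM !eqxx /=.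
by rewrite eM cK !eqxx.
Qed.

End MatrixUnits.

(** * Complemented idempotent matrices over a semifield *)

Section SemifieldWithOpposites.
Variables (F : comNzSemiRingType) (hF : semifield F) (o : F) (o1 : 1 + o = 0).

(** An alias of [F] that retains [hF] and [o1], so that the field structure they determine can be
    attached to it; [o] serves as [-1]. *)
Definition ring_of_semifield : Type := let _ := hF in let _ := o1 in F.
Local Notation K := ring_of_semifield.

HB.instance Definition _ := GRing.ComNzSemiRing.on K.

Let opp (x : K) : K := (o : K) * x.

Lemma opp_semifieldP : left_inverse 0 opp +%R.
Proof.
move=> x; rewrite /opp addrC -{1}[x]mul1r -mulrDl.
by rewrite [1 + _]o1 mul0r.
Qed.

HB.instance Definition _ := GRing.Nmodule_isZmodule.Build K opp_semifieldP.

Let inv (x : K) : K :=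
  if pselect (x != 0) is left nx then sval (cid (hF nx)) else 0.

Lemma mulVr_semifield (x : K) : x != 0 -> inv x * x = 1.
Proof.
by rewrite /inv; case: pselect => // nx _; rewrite mulrC; exact: svalP (cid (hF nx)).
Qed.

Lemma inv0_semifield : inv 0 = 0.
Proof. by rewrite /inv; case: pselect => // n0; case/negP: (n0). Qed.

HB.instance Definition _ :=
  GRing.ComNzRing_isField.Build K mulVr_semifield inv0_semifield.

(** In a rank factorisation [X Y] the factor [X] is left cancellable and [Y] right cancellable, so
    [X Y X Y = X Y] yields [Y X = 1]. *)
Lemma idempotent_factor_field n (A : 'M[F]_n) : A *m A = A ->
  exists r (X : 'M[F]_(n, r)) (Y : 'M[F]_(r, n)), X *m Y = A /\ Y *m X = 1%:M.
Proof.
move=> AA; pose B : 'M[K]_n := A.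
exists (\rank B), (col_base B : 'M[F]_(_, _)), (row_base B : 'M[F]_(_, _)).
split; first exact: (mulmx_base B).
(* The field structure on [K] extends the semiring structure of [F], so matrix products over both
   agree by conversion. *)
have BB : B *m B = B by [].
have: row_base B *m col_base B = 1%:M.
  apply: (row_free_inj (row_base_free B)).
  apply: (row_full_inj (col_base_full B)).
  rewrite mul1mx -(mulmxA (row_base B)) mulmx_base.
  by rewrite (mulmxA (col_base B) (row_base B)) mulmx_base.
by [].
Qed.

End SemifieldWithOpposites.

Lemma idempotent_factor (F : comNzSemiRingType) n (A B : 'M[F]_n) :
    semifield F -> A + B = 1%:M -> A *m B = 0 -> B *m A = 0 ->
  exists r (X : 'M[F]_(n, r)) (Y : 'M[F]_(r, n)), X *m Y = A /\ Y *m X = 1%:M.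
Proof.
move=> hF AB1 AB0 BA0.
have [[o o1]|no] := pselect (exists o : F, 1 + o = 0).
  apply: (idempotent_factor_field hF o1).
  by rewrite -[RHS]mulmx1 -AB1 mulmxDr AB0 addr0.
(* An opposite of a nonzero [a], multiplied by the inverse of [a], would be an opposite of [1]. *)
have sum0 (a b : F) : a + b = 0 -> a = 0.
  move=> ab; apply/eqP/negPn/negP => /hF [a' aa']; apply: no; exists (b * a').
  by rewrite -aa' -mulrDl ab mul0r.
have AB i j : A i j + B i j = (i == j)%:R.
  by have := congr1 (fun M : 'M_n => M i j) AB1; rewrite !mxE.
have Aoff i j : i != j -> A i j = 0.
  by move=> /negbTE nij; apply: (sum0 _ (B i j)); rewrite AB nij.
have Adiag i : A i i = 0 \/ A i i = 1.
  have [|ai] := eqVneq (A i i) 0; first by left.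
  right; have [a' aa'] := hF _ ai.
  (* Since [A] is diagonal, the diagonal of [A *m B = 0] reads entrywise; with [A i i] invertible
     this forces [B i i = 0]. *)
  have ab : A i i * B i i = 0.
    have := congr1 (fun M : 'M_n => M i i) AB0.
    rewrite !mxE (bigD1 i) //= big1 ?addr0 // => k nk.
    by rewrite Aoff 1?eq_sym // mul0r.
  have b0 : B i i = 0 by rewrite -[LHS]mul1r -aa' mulrAC ab mul0r.
  by have := AB i i; rewrite b0 addr0 eqxx.
pose D := [set i | A i i == 1].
(* The columns of [X] are the standard basis vectors indexed by [D], the set of positions of the
   entries [1] of the diagonal matrix [A]. *)
pose X : 'M[F]_(n, #|D|) := \matrix_(i, l) (i == enum_val l)%:R.
exists #|D|, X, X^T; split; apply/matrixP => i j; rewrite !mxE.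
  under eq_bigr do rewrite !mxE.
  have [iD|niD] := boolP (i \in D).
    rewrite (bigD1 (enum_rank_in iD i)) //= enum_rankK_in // eqxx mul1r.
    rewrite big1 ?addr0 => [|l nl]; last first.
      case: eqP => [il|]; rewrite ?mul0r //.
      by case/eqP: nl; apply: enum_val_inj; rewrite enum_rankK_in.
    have [<-|nij] := eqVneq i j; last by rewrite Aoff.
    by move: iD; rewrite inE => /eqP.
  rewrite big1 => [|l _].
    have [<-|/Aoff //] := eqVneq i j.
    by case: (Adiag i) => // ai; rewrite inE ai eqxx in niD.
  case: eqP => [il|]; rewrite ?mul0r //.
  by rewrite il enum_valP in niD.
under eq_bigr do rewrite !mxE.
rewrite (bigD1 (enum_val i)) //= eqxx mul1r big1 ?addr0 ?(inj_eq enum_val_inj) //.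
by move=> k /negbTE ->; rewrite mul0r.
Qed.

Lemma idempotent_family_factor (F : comNzSemiRingType) (I : finType)
    (G H : I -> I -> F) :
    semifield F ->
    (forall p q, G p q + H p q = (p == q)%:R) ->
    (forall p t, \sum_q G p q * H q t = 0) ->
    (forall p t, \sum_q H p q * G q t = 0) ->
  exists r (X : I -> 'I_r -> F) (Y : 'I_r -> I -> F),
    (forall p q, \sum_l X p l * Y l q = G p q) /\
    (forall l l', \sum_p Y l p * X p l' = (l == l')%:R).
Proof.
move=> hF GH1 GH0 HG0.
pose mx (M : I -> I -> F) : 'M[F]_#|I| := \matrix_(i, j) M (enum_val i) (enum_val j).
have mxM M N : mx M *m mx N = mx (fun p t => \sum_q M p q * N q t).
  apply/matrixP => i j; rewrite !mxE (reindex (@enum_val I predT)) /=.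
    by apply: eq_bigr => k _; rewrite !mxE.
  by apply: onW_bij; apply: enum_val_bij.
have mx0 M : (forall p q, M p q = 0) -> mx M = 0.
  by move=> M0; apply/matrixP => i j; rewrite !mxE.
have [|||r [X [Y [XY YX]]]] := @idempotent_factor F _ (mx G) (mx H) hF.
- by apply/matrixP => i j; rewrite !mxE GH1 (inj_eq enum_val_inj).
- by rewrite mxM mx0.
- by rewrite mxM mx0.
exists r, (fun p l => X (enum_rank p) l), (fun l p => Y l (enum_rank p)); split.
  move=> p q; have := congr1 (fun M : 'M_#|I| => M (enum_rank p) (enum_rank q)) XY.
  by rewrite !mxE !enum_rankK.
move=> l l'; have := congr1 (fun M : 'M_r => M l l') YX; rewrite !mxE => <-.
rewrite (reindex (@enum_rank I)) //=; apply: onW_bij; exact: enum_rank_bij.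
Qed.

(** * Transport of matrix units along a morphism of class monoids *)

Definition class_corr (S T : pzSemiRingType) (f : SV S -> SV T) (g : S) (h : T) :=
  exists2 x, idem_class g x & idem_class h (f x).

Section ClassCorrespondence.
Variables (S T : pzSemiRingType) (f : SV S -> SV T).
Hypothesis fD : forall x y, f (cm_add x y) = cm_add (f x) (f y).
Hypothesis f0 : f (cm_zero (SV S)) = cm_zero (SV T).

Lemma class_corr0 : class_corr f 0 0.
Proof.
by exists (cm_zero (SV S)); rewrite ?f0; exact: idem_class0.
Qed.

Lemma class_corrD g g' h h' : g * g' = 0 -> g' * g = 0 -> h * h' = 0 ->
  h' * h = 0 -> class_corr f g h -> class_corr f g' h' ->
  class_corr f (g + g') (h + h').
Proof.
move=> gg' g'g hh' h'h [x gx hx] [y gy hy]; exists (cm_add x y).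
  exact: idem_class_sum.
by rewrite fD; apply: idem_class_sum.
Qed.

Lemma class_corr_sum (J : eqType) (s : seq J) (g : J -> S) (h : J -> T) :
    uniq s -> {in s &, forall i j, i != j -> g i * g j = 0} ->
    {in s &, forall i j, i != j -> h i * h j = 0} ->
    {in s, forall j, class_corr f (g j) (h j)} ->
  class_corr f (\sum_(j <- s) g j) (\sum_(j <- s) h j).
Proof.
elim: s => [|i s IH] /= => [_ _ _ _|/andP[nis us] gO hO gh].
  by rewrite !big_nil; exact: class_corr0.
have ni j : j \in s -> i != j by apply: contraTneq => <-.
have ni' j : j \in s -> j != i by rewrite eq_sym; exact: ni.
have is_ : i \in i :: s by rewrite mem_head.
have inS j : j \in s -> j \in i :: s by rewrite inE orbC => ->.
rewrite !big_cons; apply: class_corrD.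
- by rewrite mulr_sumr big_seq big1 // => j js; exact: gO is_ (inS j js) (ni j js).
- by rewrite mulr_suml big_seq big1 // => j js; exact: gO (inS j js) is_ (ni' j js).
- by rewrite mulr_sumr big_seq big1 // => j js; exact: hO is_ (inS j js) (ni j js).
- by rewrite mulr_suml big_seq big1 // => j js; exact: hO (inS j js) is_ (ni' j js).
- exact: gh.
apply: IH => // [j k js ks|j k js ks|j js]; [apply: gO|apply: hO|apply: gh];
  exact: inS.
Qed.

End ClassCorrespondence.

Section ClassSplit.
Variables (S T : pzSemiRingType) (f : SV S -> SV T).
Hypothesis fD : forall x y, f (cm_add x y) = cm_add (f x) (f y).
Hypothesis f0 : f (cm_zero (SV S)) = cm_zero (SV T).

(** Induction on [s]: the class of the sum is that of the head plus that of the tail, [f] preserves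
    this sum, and [h] splits accordingly into [h1 + h2]. The tail is then realised inside [h2]. *)
Lemma class_corr_split (J : eqType) (s : seq J) (g : J -> S) (h : T) x :
    uniq s -> {in s &, forall i j, i != j -> g i * g j = 0} ->
    {in s, forall j, exists y, idem_class (g j) y} ->
    idem_class (\sum_(j <- s) g j) x -> idem_class h (f x) ->
  exists k : J -> T,
    [/\ \sum_(j <- s) k j = h,
        {in s &, forall i j, i != j -> k i * k j = 0} &
        {in s, forall j, class_corr f (g j) (k j)}].
Proof.
elim: s h x => [|i s IH] h x /= => [_ _ _|/andP[nis us] gO gC].
  rewrite big_nil => x0 hx; exists (fun=> 0); split=> //; rewrite big_nil.
  by apply/esym/idem_class_zero; rewrite -f0 (idem_class_uniq (idem_class0 S) x0).
have ni j : j \in s -> i != j by apply: contraTneq => <-.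
have ni' j : j \in s -> j != i by rewrite eq_sym; exact: ni.
have is_ : i \in i :: s by rewrite mem_head.
have inS j : j \in s -> j \in i :: s by rewrite inE orbC => ->.
rewrite big_cons => gx hx.
have gO' : {in s &, forall i j, i != j -> g i * g j = 0}.
  by move=> j k js ks; apply: gO; exact: inS.
have gC' : {in s, forall j, exists y, idem_class (g j) y}.
  by move=> j js; apply: gC; exact: inS.
have [z gz] := gC i is_.
(* Summation along the identity of [SV S] provides a class for the tail. *)
have [y gy _] : class_corr id (\sum_(j <- s) g j) (\sum_(j <- s) g j).
  apply: class_corr_sum => // j js; have [y gy] := gC' j js; by exists y.
have gS : g i * (\sum_(j <- s) g j) = 0.
  by rewrite mulr_sumr big_seq big1 // => j js; exact: gO is_ (inS j js) (ni j js).
have Sg : (\sum_(j <- s) g j) * g i = 0.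
  by rewrite mulr_suml big_seq big1 // => j js; exact: gO (inS j js) is_ (ni' j js).
have xE : x = @cm_add (SV S) z y 
  by apply: idem_class_uniq gx _; exact: idem_class_sum.
move: hx; rewrite xE fD => /idem_class_split [h1 [h2 [hE h12 h21 h1z h2y]]].
have [k [kS kO kC]] := IH _ _ us gO' gC' gy h2y.
have kI j : j \in s -> k j * k j = k j.
  by move=> js; have [w _ /idem_class_idem] := kC j js.
(* The pieces of the tail are absorbed by [h2] on both sides, hence orthogonal to [h1]. *)
have h2k j : j \in s -> h2 * k j = k j.
  move=> js; rewrite -kS mulr_suml (bigD1_seq j) //= kI // big_seq_cond.
  by rewrite big1 ?addr0 // => l /andP[ls lj]; exact: kO.
have kh2 j : j \in s -> k j * h2 = k j.
  move=> js; rewrite -kS mulr_sumr (bigD1_seq j) //= kI // big_seq_cond.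
  by rewrite big1 ?addr0 // => l /andP[ls lj]; apply: kO; rewrite // eq_sym.
pose k' j := if j == i then h1 else k j.
have k's j : j \in s -> k' j = k j by rewrite /k' => /ni' /negbTE ->.
have k'i : k' i = h1 by rewrite /k' eqxx.
exists k'; split.
- by rewrite big_cons k'i hE -kS; congr (_ + _); apply: eq_big_seq.
- move=> j l; rewrite !inE => /predU1P[->|js] /predU1P[->|ls].
  + by rewrite eqxx.
  + by move=> _; rewrite k'i k's // -h2k // mulrA h12 mul0r.
  + by move=> _; rewrite k'i k's // -kh2 // -mulrA h21 mulr0.
  + by rewrite !k's //; exact: kO.
- move=> j; rewrite inE => /predU1P[->|js]; last by rewrite k's //; exact: kC.
  by rewrite k'i; exists z.
Qed.

End ClassSplit.

Section Transport.
Variable F : comNzSemiRingType.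
Variables (I : finType) (c : I -> I).
Hypothesis cK : forall p, c (c p) = c p.
Implicit Types S T : semiAlgType F.

(** The unit of [T] is split along the images of the classes of the [e p p]. Pieces in one block
    have equal classes, and the resulting equivalences supply the off-diagonal units. That only zero
    maps to zero keeps the diagonal units nonzero. *)
Lemma mxunits_exists S T (f : SV S -> SV T) (e : I -> I -> S) :
    (forall x y, f (cm_add x y) = cm_add (f x) (f y)) ->
    f (cm_zero (SV S)) = cm_zero (SV T) ->
    (forall x, f x = cm_zero (SV T) -> x = cm_zero (SV S)) ->
    f (SV_class (fgsp_regular S)) = SV_class (fgsp_regular T) ->
    mxunits c e ->
  exists2 a : I -> I -> T, mxunits c a &
    forall p, class_corr f (e p p) (a p p).
Proof.
move=> fD f0 f0I f1 eU; have [eM se e_neq0] := eU.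
have [k []] : exists k : I -> T,
    [/\ \sum_(j <- index_enum I) k j = 1,
        {in index_enum I &, forall i j, i != j -> k i * k j = 0} &
        {in index_enum I, forall j, class_corr f (e j j) (k j)}].
  apply: (class_corr_split fD f0 (x := SV_class (fgsp_regular S))).
  - exact: index_enum_uniq.
  - by move=> i j _ _ /negbTE nij; rewrite eM nij.
  - by move=> i _; exact: mxunits_class eU i.
  - by rewrite se; exact: idem_class1.
  - by rewrite f1; exact: idem_class1.
move=> sk kO' kC'.
have kO i j : i != j -> k i * k j = 0 by apply: kO'; rewrite mem_index_enum.
have kC j : class_corr f (e j j) (k j) by apply: kC'; rewrite mem_index_enum.
have /choice [X /choice [Y XY]] : forall p, exists x y,
    [/\ x * y = k p, y * x = k (c p), k p * x = x & k (c p) * y = y].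
  move=> p; have [x ex kx] := kC p; have [y ey ky] := kC (c p).
  apply: idem_class_equiv kx _.
  have e'x : idem_class (e (c p) (c p)) x.
    by apply: (mxunits_class_block eU _ ex); rewrite cK.
  by rewrite (idem_class_uniq e'x ey).
have YX p q : Y p * X q = if p == q then k (c p) else 0.
  have [<-|npq] := eqVneq p q; first by case: (XY p).
  have [xy yx kx ky] := XY p; have [_ _ kxq _] := XY q.
  have yk : Y p * k p = Y p by rewrite -xy mulrA yx ky.
  by rewrite -yk -kxq mulrA -(mulrA (Y p)) kO // mulr0 mul0r.
(* [X p] and [Y p] relate [k p] to [k (c p)], so [X p * Y q] passes through the piece at the common
   representative. *)
exists (fun p q => if c p == c q then X p * Y q else 0); first split.
- move=> p q q' t; have [<-|nqq] := eqVneq q q'; last first.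
    do 2 case: ifP => _; rewrite ?mul0r ?mulr0 //.
    by rewrite -mulrA (mulrA (Y q)) YX (negbTE nqq) mul0r mulr0.
  have [->|npq] := eqVneq (c p) (c q); last by rewrite mul0r.
  have [qt|nqt] := eqVneq (c q) (c t); last by rewrite mulr0.
  by rewrite -mulrA (mulrA (Y q)) YX eqxx qt; have [_ _ _ ->] := XY t.
- by rewrite -[RHS]sk; apply: eq_bigr => p _; rewrite eqxx; case: (XY p).
- move=> p; rewrite eqxx; have [-> _ _ _] := XY p; have [x ex kx] := kC p.
  apply/eqP => k0; move: kx; rewrite k0 => kx.
  have x0 := f0I x (idem_class_uniq kx (idem_class0 T)).
  move: ex; rewrite x0 => /idem_class_zero /eqP.
  by rewrite (negbTE (e_neq0 p)).
by move=> p; rewrite eqxx; have [-> _ _ _] := XY p.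
Qed.

End Transport.

(** * Classes of complemented idempotents in the span of matrix units *)

Section Transfer.
Variable F : comNzSemiRingType.
Hypothesis hF : semifield F.
Variables (I : finType) (c : I -> I).
Hypothesis cK : forall p, c (c p) = c p.
Implicit Types S T : semiAlgType F.

Section Factor.
Variables (S : semiAlgType F) (e : I -> I -> S) (k : I) (r : nat).
Variables (X : I -> 'I_r -> F) (Y : 'I_r -> I -> F).
Hypothesis eU : mxunits c e.
Hypothesis Xk : forall p l, c p != c k -> X p l = 0.
Hypothesis YX : forall l l', \sum_p Y l p * X p l' = (l == l')%:R.

(** Columns of [X] and rows of [Y], placed in the column and the row of index [k] of its block, so
    that a row times a column is a multiple of [e k k]. *)
Definition factor_col l : S := \sum_p X p l *: e p k.
Definition factor_row l : S := \sum_q Y l q *: e k q.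

Lemma factor_row_col l l' :
  factor_row l * factor_col l' = if l == l' then e k k else 0.
Proof.
have [eM _ _] := eU.
rewrite /factor_row mulr_suml -[RHS](_ : (\sum_q Y l q * X q l') *: e k k = _).
  rewrite scaler_suml; apply: eq_bigr => q _.
  rewrite /factor_col mulr_sumr (bigD1 q) //= big1 ?addr0.
    rewrite -scalerAl -scalerAr scalerA eM eqxx.
    by case: eqP => // /eqP; rewrite eq_sym => /Xk ->; rewrite mulr0 !scale0r.
  move=> p /negbTE; rewrite eq_sym => np.
  by rewrite -scalerAl -scalerAr eM np !scaler0.
by rewrite YX; case: eqP; rewrite ?scale1r ?scale0r.
Qed.

Lemma factor_col_row l :
  factor_col l * factor_row l = comb e (fun p q => X p l * Y l q).
Proof.
have [eM _ _] := eU.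
rewrite /factor_col mulr_suml; apply: eq_bigr => p _.
rewrite /factor_row mulr_sumr; apply: eq_bigr => q _.
rewrite -scalerAl -scalerAr scalerA eM eqxx.
by case: eqP => // /eqP /Xk ->; rewrite mul0r !scale0r.
Qed.

Lemma factor_row_unit l : e k k * factor_row l = factor_row l.
Proof.
have [eM _ _] := eU.
rewrite /factor_row mulr_sumr; apply: eq_bigr => q _.
by rewrite -scalerAr eM !eqxx.
Qed.

Lemma factor_orth l l' : l != l' ->
  factor_col l * factor_row l * (factor_col l' * factor_row l') = 0.
Proof.
move=> /negbTE ll.
by rewrite -mulrA (mulrA (factor_row l)) factor_row_col ll mul0r mulr0.
Qed.

Lemma factor_class l x : idem_class (e k k) x ->
  idem_class (factor_col l * factor_row l) x.
Proof.
apply: (@equiv_idem_class _ _ _ (factor_row l) (factor_col l)) => //.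
  by rewrite factor_row_col eqxx.
exact: factor_row_unit.
Qed.

End Factor.

Variables (S T : semiAlgType F) (f : SV S -> SV T).
Hypothesis fD : forall x y, f (cm_add x y) = cm_add (f x) (f y).
Hypothesis f0 : f (cm_zero (SV S)) = cm_zero (SV T).
Variables (e : I -> I -> S) (a : I -> I -> T).
Hypotheses (eU : mxunits c e) (aU : mxunits c a).
Hypothesis ea : forall p, class_corr f (e p p) (a p p).

(** Factoring the coefficient matrix as [X Y] with [Y X = 1] writes the idempotent as a sum of [r]
    orthogonal ones, each equivalent to the diagonal unit at [k]. The same [X] and [Y] serve in [S]
    and in [T]. *)
Lemma class_corr_block (G H : I -> I -> F) (k : I) :
    (forall p q, c p != c k -> G p q = 0) ->
    (forall p q, G p q + H p q = (p == q)%:R) ->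
    (forall p t, \sum_q G p q * H q t = 0) ->
    (forall p t, \sum_q H p q * G q t = 0) ->
  class_corr f (comb e G) (comb a G).
Proof.
move=> Gk GH1 GH0 HG0.
have [r [X [Y [XY YX]]]] := idempotent_family_factor hF GH1 GH0 HG0.
have Xk p l : c p != c k -> X p l = 0.
  (* From [Y X = 1] follows [X = G X], so [X] vanishes on the rows where [G] does. *)
  move=> pk; transitivity (\sum_q G p q * X q l).
    transitivity (\sum_l' X p l' * (l' == l)%:R).
      rewrite (bigD1 l) //= eqxx mulr1 big1 ?addr0 // => l' /negbTE ->.
      by rewrite mulr0.
    under eq_bigr do rewrite -YX mulr_sumr.
    rewrite exchange_big; apply: eq_bigr => q _.
    by rewrite -XY mulr_suml; apply: eq_bigr => l' _; rewrite mulrA.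
  by rewrite big1 // => q _; rewrite Gk // mul0r.
have combE (A : semiAlgType F) (d : I -> I -> A) : mxunits c d ->
    comb d G = \sum_l factor_col d k X l * factor_row d k Y l.
  move=> dU; under eq_bigr do rewrite (factor_col_row Y dU Xk).
  rewrite comb_sum; apply: eq_bigr => p _; apply: eq_bigr => q _.
  by rewrite XY.
rewrite !combE //; apply: class_corr_sum => //.
- exact: index_enum_uniq.
- by move=> l l' _ _; exact: (factor_orth eU Xk YX).
- by move=> l l' _ _; exact: (factor_orth aU Xk YX).
move=> l _; have [x ex ax] := ea k; exists x.
  exact: (factor_class eU Xk YX).
exact: (factor_class aU Xk YX).
Qed.

(** The idempotent is the orthogonal sum of its parts in the blocks, which are treated one at a
    time. Torsion-freeness turns the equations in [S] into equations between coefficients, which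
    then hold for [T] as well. *)
Lemma class_corr_comb (tf : torsion_free S) l m :
    comb e l + comb e m = 1 -> comb e l * comb e m = 0 ->
    comb e m * comb e l = 0 ->
  class_corr f (comb e l) (comb a l).
Proof.
move=> lm1 lm0 ml0.
(* Coefficients outside the blocks are arbitrary; setting them to [0] makes the matrix identities
   hold at every pair of indices. *)
pose G p q := if c p == c q then l p q else 0.
pose H p q := if c p == c q then m p q else 0.
have GH1 p q : G p q + H p q = (p == q)%:R.
  rewrite /G /H; have [pq|npq] := eqVneq (c p) (c q).
    by rewrite -(comb1 eU) combD in lm1; exact: (comb_inj eU tf lm1 pq).
  by rewrite addr0; case: (eqVneq p q) npq => [->|//]; rewrite eqxx.
have prod0 (u v : I -> I -> F) : comb e u * comb e v = 0 -> forall p t,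
    \sum_q (if c p == c q then u p q else 0) * (if c q == c t then v q t else 0)
    = 0.
  rewrite (combM eU) -[RHS](_ : comb e (fun p q => 0) = 0) => [uv p t|]; last first.
    by rewrite /comb big1 // => p _; rewrite big1 // => q _; rewrite scale0r.
  have [pt|npt] := eqVneq (c p) (c t).
    rewrite -[RHS](comb_inj eU tf uv pt) [RHS]big_mkcond; apply: eq_bigr => q _.
    by case: eqP => [<-|]; rewrite ?mul0r // pt eqxx.
  rewrite big1 // => q _; case: eqP => [<-|]; rewrite ?mul0r //.
  by rewrite (negbTE npt) mulr0.
have GH0 := prod0 _ _ lm0; have HG0 := prod0 _ _ ml0.
pose Gk k p q := if c p == k then G p q else 0.
(* The complement of the part in block [k] is completed by the identity on the other blocks. *)
pose Hk k p q := if c p == k then H p q else (p == q)%:R.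
have combE (A : semiAlgType F) (d : I -> I -> A) : mxunits c d ->
    comb d l = \sum_(k <- index_enum I) comb d (Gk k).
  move=> dU; rewrite (comb_block dU) comb_sum.
  apply: eq_bigr => p _; apply: eq_bigr => q _; congr (_ *: _).
  rewrite (bigD1 (c p)) //= /Gk eqxx big1 ?addr0 // => k /negbTE.
  by rewrite eq_sym => ->.
have Gorth (A : semiAlgType F) (d : I -> I -> A) : mxunits c d ->
    forall k k', k != k' -> comb d (Gk k) * comb d (Gk k') = 0.
  move=> dU k k' kk'; rewrite (combM dU) /comb big1 // => p _; rewrite big1 // => t _.
  rewrite big1 ?scale0r // => q /eqP pq; rewrite /Gk -pq.
  by case: eqP => [->|]; rewrite ?mul0r // (negbTE kk') mulr0.
rewrite !combE //; apply: class_corr_sum => //.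
- exact: index_enum_uniq.
- by move=> k k' _ _; exact: Gorth.
- by move=> k k' _ _; exact: Gorth.
(* The sum runs over all indices, but only representatives of blocks contribute. *)
move=> k _; have [kk|nkk] := eqVneq (c k) k; last first.
  have Gk0 p q : Gk k p q = 0.
    by rewrite /Gk; case: eqP => // pk; rewrite -pk cK eqxx in nkk.
  have c0 (A : semiAlgType F) (d : I -> I -> A) : comb d (Gk k) = 0.
    rewrite /comb big1 // => p _; rewrite big1 // => q _.
    by rewrite Gk0 scale0r.
  by rewrite !c0; exact: class_corr0.
apply: (@class_corr_block _ (Hk k) k).
- by move=> p q; rewrite kk /Gk => /negbTE ->.
- by move=> p q; rewrite /Gk /Hk; case: eqP; rewrite ?GH1 ?add0r.
- move=> p t; rewrite /Gk; case: eqP => [pk|_]; last first.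
    by rewrite big1 // => q _; rewrite mul0r.
  rewrite -[RHS](GH0 p t); apply: eq_bigr => q _; rewrite /Hk /G /H.
  by have [<-|] := eqVneq (c p) (c q); rewrite ?mul0r // pk eqxx.
move=> p t; rewrite /Hk; have [pk|npk] := eqVneq (c p) k.
  rewrite -[RHS](HG0 p t); apply: eq_bigr => q _; rewrite /Gk /G /H.
  by have [<-|] := eqVneq (c p) (c q); rewrite ?mul0r // pk eqxx.
rewrite (bigD1 p) //= /Gk (negbTE npk) mulr0 add0r big1 // => q /negbTE.
by rewrite eq_sym => ->; rewrite mul0r.
Qed.

End Transfer.

(** * The back-and-forth construction *)

Section Filtration.
Variable F : comNzSemiRingType.

Definition in_span (I : finType) (S : semiAlgType F) (e : I -> I -> S) (s : S) :=
  exists l, s = comb e l.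

(** Only the spans are nested; the systems of matrix units at different stages are unrelated. *)
Record mx_filtration (S : semiAlgType F) := MxFiltration {
  mxf_index : nat -> finType;
  mxf_block : forall n, mxf_index n -> mxf_index n;
  mxf_unit : forall n, mxf_index n -> mxf_index n -> S;
  mxf_blockK : forall n p, @mxf_block n (mxf_block p) = mxf_block p;
  mxf_units : forall n, mxunits (@mxf_block n) (@mxf_unit n);
  mxf_mono : forall n s, in_span (@mxf_unit n) s -> in_span (@mxf_unit n.+1) s;
  mxf_cover : forall s, exists n, in_span (@mxf_unit n) s }.

Lemma in_span_mono (S : semiAlgType F) (E : mx_filtration S) m n s :
  (m <= n)%N -> in_span (@mxf_unit S E m) s -> in_span (@mxf_unit S E n) s.
Proof.
move=> /subnK <-; elim: (n - m)%N => // k IH /IH; exact: mxf_mono.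
Qed.

Lemma in_span_common (S : semiAlgType F) (E : mx_filtration S) (J : finType)
    (s : J -> S) n0 :
  exists2 n, (n0 <= n)%N & forall j, in_span (@mxf_unit S E n) (s j).
Proof.
have /choice [N sN] := fun j => mxf_cover E (s j).
exists (maxn n0 (\max_j N j)) => [|j]; first exact: leq_maxl.
apply: in_span_mono (sN j); apply: leq_trans (leq_maxr _ _).
exact: leq_bigmax.
Qed.

End Filtration.

Section GraphSub.
Variables (F : comNzSemiRingType) (I J : finType) (S T : semiAlgType F).

(** The pairs [(e p q, a p q)] generate the graph under scaling and sums. *)
Lemma graph_sub (e : I -> I -> S) (a : I -> I -> T) (e' : J -> J -> S)
    (a' : J -> J -> T) :
  (forall p q, graph e' a' (e p q) (a p q)) ->
  forall s t, graph e a s t -> graph e' a' s t.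
Proof.
move=> ea s t [l -> ->]; apply: graph_sum => p; apply: graph_sum => q.
exact: graphZ.
Qed.

End GraphSub.

(** * Extending a partial isomorphism in one direction *)

Section HalfStep.
Variable F : comNzSemiRingType.
Hypothesis hF : semifield F.
Variables (S T : semiAlgType F) (f : SV S -> SV T) (g : SV T -> SV S).
Hypotheses (tfS : torsion_free S) (tfT : torsion_free T).
Hypothesis fK : cancel f g.
Hypothesis gK : cancel g f.
Hypothesis gD : forall x y, g (cm_add x y) = cm_add (g x) (g y).
Hypothesis g0 : g (cm_zero (SV T)) = cm_zero (SV S).
Hypothesis g1 : g (SV_class (fgsp_regular T)) = SV_class (fgsp_regular S).
Variables (I J : finType) (c : I -> I) (d : J -> J).
Hypotheses (cK : forall p, c (c p) = c p) (dK : forall p, d (d p) = d p).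

(** [eps] is transported along [g] to a system [b0] of [S]. The resulting map carries [a] to a
    system [e'] with the same diagonal classes as [e], and conjugating [b0] by a unit taking [e'] to
    [e] makes the new map extend the inverse of the old one. *)
Lemma half_step (e : I -> I -> S) (a : I -> I -> T) (eps : J -> J -> T) :
    mxunits c e -> mxunits c a -> mxunits d eps ->
    (forall p, class_corr f (e p p) (a p p)) ->
    (forall p q, in_span eps (a p q)) ->
  exists b : J -> J -> S,
    [/\ mxunits d b, forall p, class_corr g (eps p p) (b p p) &
        forall p q, graph eps b (a p q) (e p q)].
Proof.
move=> eU aU epsU ea aspan; have [aM sa a_neq0] := aU.
have [b0 b0U eb] : exists2 b0 : J -> J -> S, mxunits d b0 &
    forall p, class_corr g (eps p p) (b0 p p).
  apply: (mxunits_exists dK gD g0 _ g1 epsU) => x gx0.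
  by apply: (can_inj gK); rewrite gx0 g0.
have /choice [l al] := fun pq : I * I => aspan pq.1 pq.2.
pose e' p q := comb b0 (l (p, q)).
have ae' p q : graph eps b0 (a p q) (e' p q).
  by exists (l (p, q)); rewrite // -al.
have gfun := graph_fun epsU b0U tfT.
have gfun' := graph_fun b0U epsU tfS.
(* The graph from [eps] to [b0] is single-valued in both directions and respects products, so the
   relations of [a] pass to [e']. *)
have e'U : mxunits c e'.
  split=> [p q q' t||p].
  - apply: gfun (graphM epsU b0U (ae' p q) (ae' q' t)) _; rewrite aM.
    by case: ifP => _; [exact: ae' | exact: graph0].
  - apply: gfun (graph_sum _ _ (fun p => ae' p p)) _; rewrite sa.
    exact: (graph1 epsU b0U).
  apply/eqP => e'0; have /graph_sym := ae' p p; rewrite e'0 => ga.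
  have := a_neq0 p; rewrite (gfun' _ _ _ ga (graph0 _ _)) eqxx //.
have ae'C p : class_corr g (a p p) (e' p p).
  have [E1 E2 E3] := mxunits_compl aU p.
  (* The coefficients over [eps] of the complement of [a p p], which is the sum of the other
     diagonal units of [a]. *)
  pose m p' q' := \sum_(q | q != p) l (q, q) p' q'.
  have mE : comb eps m = \sum_(q | q != p) a q q.
    by rewrite -comb_sum; apply: eq_bigr => q _; rewrite -al.
  rewrite (al (p, p)); apply: (class_corr_comb hF dK gD g0 epsU b0U eb tfT (m := m));
    by rewrite mE -al.
have [|u [v [uv vu eE]]] := mxunits_unique cK eU e'U.
  (* The class of [e' p p] is the image under [g] of the class [f x] of [a p p], that is, [x]. *)
  move=> p; have [x ex ax] := ea p; have [y ay e'y] := ae'C p.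
  by exists x => //; rewrite -(fK x) (idem_class_uniq ax ay).
exists (fun p q => u * b0 p q * v); split.
- exact: mxunits_conj.
- move=> p; have [x ex bx] := eb p; exists x => //.
  have [bM _ _] := b0U; have bI : b0 p p * b0 p p = b0 p p by rewrite bM !eqxx.
  apply: (@equiv_idem_class _ _ _ (b0 p p * v) (u * b0 p p)) bx.
  + by rewrite -mulrA (mulrA v) vu mul1r.
  + by rewrite -mulrA (mulrA (b0 p p)) bI mulrA.
  + by rewrite mulrA bI.
move=> p q; exists (l (p, q)); first by rewrite -al.
rewrite eE /e' /comb mulr_sumr mulr_suml; apply: eq_bigr => p' _.
rewrite mulr_sumr mulr_suml; apply: eq_bigr => q' _.
by rewrite -scalerAr -scalerAl.
Qed.

End HalfStep.

Section BackAndForth.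
Variable F : comNzSemiRingType.
Hypothesis hF : semifield F.
Variables (S T : semiAlgType F) (f : SV S -> SV T) (g : SV T -> SV S).
Hypotheses (tfS : torsion_free S) (tfT : torsion_free T).
Hypotheses (fK : cancel f g) (gK : cancel g f).
Hypothesis fD : forall x y, f (cm_add x y) = cm_add (f x) (f y).
Hypothesis f0 : f (cm_zero (SV S)) = cm_zero (SV T).
Hypothesis f1 : f (SV_class (fgsp_regular S)) = SV_class (fgsp_regular T).
Variables (E : mx_filtration S) (D : mx_filtration T).

Let gD x y : g (cm_add x y) = cm_add (g x) (g y).
Proof. by apply: (can_inj fK); rewrite fD !gK. Qed.

Let g0 : g (cm_zero (SV T)) = cm_zero (SV S).
Proof. by rewrite -f0 fK. Qed.

Let g1 : g (SV_class (fgsp_regular T)) = SV_class (fgsp_regular S).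
Proof. by rewrite -f1 fK. Qed.

Local Notation e := (@mxf_unit F S E).
Local Notation eps := (@mxf_unit F T D).

Definition compatible k (a : mxf_index E k -> mxf_index E k -> T) : Prop :=
  mxunits (@mxf_block F S E k) a /\
  forall p, class_corr f (e p p) (a p p).

(** A partial isomorphism on the span of the [k]-th system of [E], recorded by the images in [T] of
    its matrix units. *)
Definition stage : Type :=
  {k : nat & {a : mxf_index E k -> mxf_index E k -> T | compatible a}}.

Definition stage_graph (s : stage) : S -> T -> Prop :=
  graph (@e (projT1 s)) (sval (projT2 s)).

Lemma stage_exists : inhabited stage.
Proof.
have [|a aU ea] := mxunits_exists (@mxf_blockK F S E 0) fD f0 _ f1 (mxf_units E 0).
  by move=> x fx0; apply: (can_inj fK); rewrite fx0 f0.
by split; exists 0, a.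
Qed.

(** Two half steps, back to [S] through a late system of [D] and forth to [T] through a late system
    of [E]. Going beyond index [n] on both sides is what exhausts both algebras in the limit. *)
Lemma stage_step (n : nat) (s : stage) : exists s' : stage,
  [/\ (n <= projT1 s')%N,
      forall x y, stage_graph s x y -> stage_graph s' x y &
      forall y, in_span (@eps n) y -> exists x, stage_graph s' x y].
Proof.
case: s => k [a [aU ea]].
have [j nj aj] := in_span_common D (fun pq => a pq.1 pq.2) n.
have [b [bU eb ab]] := half_step hF tfS tfT fK gK gD g0 g1 (@mxf_blockK F S E k)
  (@mxf_blockK F T D j) (mxf_units E k) aU (mxf_units D j) ea
  (fun p q => aj (p, q)).
have [k' nk' bk'] := in_span_common E (fun pq => b pq.1 pq.2) n.
have [a' [a'U ea' ba']] := half_step hF tfT tfS gK fK fD f0 f1 (@mxf_blockK F T D j)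
  (@mxf_blockK F S E k') (mxf_units D j) bU (mxf_units E k') eb
  (fun p q => bk' (p, q)).
exists (existT _ k' (exist _ a' (conj a'U ea'))); split=> // [x y|y ny].
  rewrite /stage_graph /= => /graph_sym /(graph_sub ab) /graph_sym.
  exact: graph_sub ba' _ _.
have [l ->] := in_span_mono nj ny; exists (comb b l).
by apply: (graph_sub ba'); exists l.
Qed.

Lemma stage_graph_fun s x y y' : stage_graph s x y -> stage_graph s x y' -> y = y'.
Proof.
case: s => k [a [aU ea]]; exact: graph_fun (mxf_units E k) aU tfS _ _ _.
Qed.

Lemma stage_graph_inj s x x' y : stage_graph s x y -> stage_graph s x' y -> x = x'.
Proof.
case: s => k [a [aU ea]] /graph_sym xy /graph_sym x'y.
exact: graph_fun aU (mxf_units E k) tfT _ _ _ xy x'y.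
Qed.

Lemma alg_iso_of_SV_iso : alg_iso S T.
Proof.
have [s0] := stage_exists.
have /choice [next nextP] := fun ns : nat * stage => stage_step ns.1 ns.2.
(* Step [n] brings the [n]-th spans of both filtrations into the domain and the range, so they are
   covered by [st n.+1]. *)
pose st := fix st n := if n is n'.+1 then next (n', st n') else s0.
have st_mono m n x y : (m <= n)%N -> stage_graph (st m) x y ->
    stage_graph (st n) x y.
  move=> /subnK <-; elim: (n - m)%N => // i IH /IH.
  by have [_ H _] := nextP ((i + m)%N, st (i + m)%N); exact: H.
(* The union of the increasing chain; any two of its pairs lie in a common stage. *)
pose R x y := exists n, stage_graph (st n) x y.
have Rcommon x y x' y' : R x y -> R x' y' ->
    exists n, stage_graph (st n) x y /\ stage_graph (st n) x' y'.
  move=> [m xy] [n x'y']; exists (maxn m n); split.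
    exact: st_mono (leq_maxl _ _) xy.
  exact: st_mono (leq_maxr _ _) x'y'.
have Rfun x y y' : R x y -> R x y' -> y = y'.
  move=> h h'; have [n [H H']] := Rcommon _ _ _ _ h h'.
  exact: stage_graph_fun H H'.
have Rinj x x' y : R x y -> R x' y -> x = x'.
  move=> h h'; have [n [H H']] := Rcommon _ _ _ _ h h'.
  exact: stage_graph_inj H H'.
have /choice [h hR] x : exists y, R x y.
  have [n nx] := mxf_cover E x; have [nk _ _] := nextP (n, st n).
  have [l ->] := in_span_mono nk nx.
  by exists (comb (sval (projT2 (st n.+1))) l); exists n.+1, l.
have /choice [h' hR'] y : exists x, R x y.
  have [n ny] := mxf_cover D y; have [_ _ H] := nextP (n, st n).
  by have [x xy] := H y ny; exists x, n.+1.
have Runits n : mxunits (@mxf_block F S E (projT1 (st n))) (sval (projT2 (st n))).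
  by case: (st n) => k [a []].
have hD x y : h (x + y) = h x + h y.
  have [n [H H']] := Rcommon _ _ _ _ (hR x) (hR y).
  by apply: Rfun (hR _) _; exists n; exact: graphD H H'.
have hM x y : h (x * y) = h x * h y.
  have [n [H H']] := Rcommon _ _ _ _ (hR x) (hR y).
  apply: Rfun (hR _) _; exists n.
  exact: graphM (mxf_units E _) (Runits n) _ _ _ _ H H'.
have hZ k x : h (k *: x) = k *: h x.
  have [n H] := hR x.
  by apply: Rfun (hR _) _; exists n; exact: graphZ.
have h1 : h 1 = 1.
  by apply: Rfun (hR _) _; exists 0%N; exact: (graph1 (mxf_units E _) (Runits 0%N)).
pose hL := GRing.isSemilinear.Build F S T *:%R h (conj hZ hD).
pose hMo := GRing.isMonoidMorphism.Build S T h (conj h1 hM).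
pose hh : {lrmorphism S -> T} := HB.pack h hL hMo.
exists hh; exists h' => [x|y] /=.
  exact: Rinj (hR' _) (hR x).
exact: Rfun (hR _) (hR' y).
Qed.

End BackAndForth.

(** * Direct limits of algebras *)

Section Germ.
Local Open Scope quotient_scope.
Variables (F : comNzSemiRingType) (A : nat -> semiAlgType F).

(** Sequences modulo eventual equality form a nonzero algebra, a target for the universal property
    in which two elements are identified only if they agree at all late stages. Classical choice
    structure is needed to form the quotient. *)
Definition seqs : Type := {classic forall k, A k}.
HB.instance Definition _ := Choice.on seqs.

Definition germ_eq (x y : seqs) : bool :=
  `[< exists N, forall k, (N <= k)%N -> x k = y k >].

Lemma germ_eqP (x y : seqs) :
  reflect (exists N, forall k, (N <= k)%N -> x k = y k) (germ_eq x y).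
Proof. exact: asboolP. Qed.

Lemma germ_eq_equiv : equiv_class_of germ_eq.
Proof.
split=> [x|x y|y x z].
- by apply/germ_eqP; exists 0%N.
- by apply/germ_eqP/germ_eqP => -[N xy]; exists N => k /xy.
move=> /germ_eqP [M xy] /germ_eqP [N yz]; apply/germ_eqP; exists (maxn M N) => k.
by rewrite geq_max => /andP[Mk Nk]; rewrite xy // yz.
Qed.

Canonical germ_eq_equivRel := EquivRelPack germ_eq_equiv.

Definition germ : Type := {eq_quot germ_eq}.
HB.instance Definition _ := Choice.on germ.

Definition germ_of (x : seqs) : germ := \pi_({eq_quot germ_eq}) x.
Definition germ_repr (x : germ) : seqs := repr (x : {eq_quot germ_eq}).

Lemma germ_ofP (x y : seqs) :
  germ_of x = germ_of y <-> exists N, forall k, (N <= k)%N -> x k = y k.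
Proof.
split; first by move/eqmodP/germ_eqP.
by move=> xy; apply/eqmodP/germ_eqP.
Qed.

Lemma germ_reprK x : germ_of (germ_repr x) = x.
Proof. exact: reprK. Qed.

Lemma germ_repr_of (x : seqs) :
  exists N, forall k, (N <= k)%N -> germ_repr (germ_of x) k = x k.
Proof. by apply/germ_ofP; rewrite germ_reprK. Qed.

Definition germ_add (x y : germ) : germ :=
  germ_of (fun k => germ_repr x k + germ_repr y k).
Definition germ_mul (x y : germ) : germ :=
  germ_of (fun k => germ_repr x k * germ_repr y k).
Definition germ_scale (a : F) (x : germ) : germ :=
  germ_of (fun k => a *: germ_repr x k).

Lemma germ_addE x y :
  germ_add (germ_of x) (germ_of y) = germ_of (fun k => x k + y k).
Proof.
apply/germ_ofP; have [M xM] := germ_repr_of x; have [N yN] := germ_repr_of y.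
by exists (maxn M N) => k; rewrite geq_max => /andP[/xM -> /yN ->].
Qed.

Lemma germ_mulE x y :
  germ_mul (germ_of x) (germ_of y) = germ_of (fun k => x k * y k).
Proof.
apply/germ_ofP; have [M xM] := germ_repr_of x; have [N yN] := germ_repr_of y.
by exists (maxn M N) => k; rewrite geq_max => /andP[/xM -> /yN ->].
Qed.

Lemma germ_scaleE a x : germ_scale a (germ_of x) = germ_of (fun k => a *: x k).
Proof.
by apply/germ_ofP; have [M xM] := germ_repr_of x; exists M => k /xM ->.
Qed.

Lemma germ_ext (x y : seqs) : (forall k, x k = y k) -> germ_of x = germ_of y.
Proof. by move=> xy; apply/germ_ofP; exists 0%N. Qed.

Lemma germ_ind (P : germ -> Prop) : (forall x, P (germ_of x)) -> forall x, P x.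
Proof. by move=> H x; rewrite -(germ_reprK x). Qed.

Let germ0 : germ := germ_of (fun k => 0).
Let germ1 : germ := germ_of (fun k => 1).

Let germ_addA : associative germ_add.
Proof.
elim/germ_ind=> x; elim/germ_ind=> y; elim/germ_ind=> z.
by rewrite !germ_addE; apply: germ_ext => k; rewrite addrA.
Qed.

Let germ_addC : commutative germ_add.
Proof.
elim/germ_ind=> x; elim/germ_ind=> y.
by rewrite !germ_addE; apply: germ_ext => k; rewrite addrC.
Qed.

Let germ_add0 : left_id germ0 germ_add.
Proof.
by elim/germ_ind=> x; rewrite germ_addE; apply: germ_ext => k; rewrite add0r.
Qed.

HB.instance Definition _ :=
  GRing.isNmodule.Build germ germ_addA germ_addC germ_add0.

Let germ_mulA : associative germ_mul.
Proof.
elim/germ_ind=> x; elim/germ_ind=> y; elim/germ_ind=> z.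
by rewrite !germ_mulE; apply: germ_ext => k; rewrite mulrA.
Qed.

Let germ_mul1r : left_id germ1 germ_mul.
Proof.
by elim/germ_ind=> x; rewrite germ_mulE; apply: germ_ext => k; rewrite mul1r.
Qed.

Let germ_mulr1 : right_id germ1 germ_mul.
Proof.
by elim/germ_ind=> x; rewrite germ_mulE; apply: germ_ext => k; rewrite mulr1.
Qed.

Let germ_mulDl : left_distributive germ_mul germ_add.
Proof.
elim/germ_ind=> x; elim/germ_ind=> y; elim/germ_ind=> z.
rewrite !(germ_addE, germ_mulE); apply: germ_ext => k; exact: mulrDl.
Qed.

Let germ_mulDr : right_distributive germ_mul germ_add.
Proof.
elim/germ_ind=> x; elim/germ_ind=> y; elim/germ_ind=> z.
rewrite !(germ_addE, germ_mulE); apply: germ_ext => k; exact: mulrDr.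
Qed.

Let germ_mul0r : left_zero germ0 germ_mul.
Proof.
by elim/germ_ind=> x; rewrite germ_mulE; apply: germ_ext => k; rewrite mul0r.
Qed.

Let germ_mulr0 : right_zero germ0 germ_mul.
Proof.
by elim/germ_ind=> x; rewrite germ_mulE; apply: germ_ext => k; rewrite mulr0.
Qed.

Let germ_1neq0 : germ1 != germ0.
Proof.
apply/eqP => /germ_ofP [N /(_ N (leqnn N)) /eqP]; by rewrite oner_eq0.
Qed.

HB.instance Definition _ := GRing.Nmodule_isNzSemiRing.Build germ
  germ_mulA germ_mul1r germ_mulr1 germ_mulDl germ_mulDr germ_mul0r germ_mulr0
  germ_1neq0.

Let germ_scaleA a b v : germ_scale a (germ_scale b v) = germ_scale (a * b) v.
Proof.
elim/germ_ind: v => x; rewrite !germ_scaleE; apply: germ_ext => k.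
exact: scalerA.
Qed.

Let germ_scale0r v : germ_scale 0 v = 0.
Proof.
by elim/germ_ind: v => x; rewrite germ_scaleE; apply: germ_ext => k; rewrite scale0r.
Qed.

Let germ_scale1r : left_id 1 germ_scale.
Proof.
by elim/germ_ind => x; rewrite germ_scaleE; apply: germ_ext => k; rewrite scale1r.
Qed.

Let germ_scaleDr : right_distributive germ_scale +%R.
Proof.
move=> a; elim/germ_ind=> x; elim/germ_ind=> y.
rewrite [_ + _]germ_addE !germ_scaleE [RHS]germ_addE; apply: germ_ext => k.
exact: scalerDr.
Qed.

Let germ_scaleDl v : {morph germ_scale^~ v : a b / a + b}.
Proof.
move=> a b; elim/germ_ind: v => x.
rewrite !germ_scaleE [RHS]germ_addE; apply: germ_ext => k.
exact: scalerDl.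
Qed.

HB.instance Definition _ := GRing.Nmodule_isLSemiModule.Build F germ
  germ_scaleA germ_scale0r germ_scale1r germ_scaleDr germ_scaleDl.

Let germ_scaleAl (a : F) (u v : germ) : a *: (u * v) = (a *: u) * v.
Proof.
elim/germ_ind: u => x; elim/germ_ind: v => y.
rewrite [_ * _]germ_mulE [_ *: _]germ_scaleE [a *: germ_of x]germ_scaleE.
rewrite [RHS]germ_mulE; apply: germ_ext => k; exact: scalerAl.
Qed.

HB.instance Definition _ :=
  GRing.LSemiModule_isLSemiAlgebra.Build F germ germ_scaleAl.

Let germ_scaleAr (a : F) (u v : germ) : a *: (u * v) = u * (a *: v).
Proof.
elim/germ_ind: u => x; elim/germ_ind: v => y.
rewrite [_ * _]germ_mulE [_ *: _]germ_scaleE [a *: germ_of y]germ_scaleE.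
rewrite [RHS]germ_mulE; apply: germ_ext => k; exact: scalerAr.
Qed.

HB.instance Definition _ :=
  GRing.LSemiAlgebra_isSemiAlgebra.Build F germ germ_scaleAr.

End Germ.

Section DirectLimit.
Variables (F : comNzSemiRingType) (A : nat -> semiAlgType F).
Variable phi : forall i, {lrmorphism A i -> A i.+1}.

(* The image of [x] at stage [k]; it is [0] for [k < i]. *)
Fixpoint push (i : nat) (x : A i) (k : nat) : A k :=
  match i =P k with
  | ReflectT ik => ecast k (A k) ik x
  | ReflectF _ => match k return A k with 0 => 0 | k'.+1 => phi k' (push x k') end
  end.

Lemma push_id i (x : A i) : push x i = x.
Proof.
by case: i x => [|i] x /=; case: eqP => // ii; rewrite (eq_irrelevance ii erefl).
Qed.

Lemma push_step i (x : A i) k : (i <= k)%N -> push x k.+1 = phi k (push x k).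
Proof. by move=> ik /=; case: eqP => // ik1; rewrite ik1 ltnn in ik. Qed.

Lemma leq_ind i (P : nat -> Prop) :
  P i -> (forall k, (i <= k)%N -> P k -> P k.+1) -> forall k, (i <= k)%N -> P k.
Proof.
move=> Pi Pk k /subnK <-; elim: (k - i)%N => // d IH.
by apply: Pk => //; rewrite leq_addl.
Qed.

Lemma pushD i (x y : A i) : forall k, (i <= k)%N ->
  push (x + y) k = push x k + push y k.
Proof.
apply: leq_ind => [|k ik IH]; first by rewrite !push_id.
by rewrite !push_step // IH raddfD.
Qed.

Lemma pushM i (x y : A i) : forall k, (i <= k)%N ->
  push (x * y) k = push x k * push y k.
Proof.
apply: leq_ind => [|k ik IH]; first by rewrite !push_id.
by rewrite !push_step // IH rmorphM.
Qed.

Lemma push1 i : forall k, (i <= k)%N -> push (1 : A i) k = 1.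
Proof.
apply: leq_ind => [|k ik IH]; first by rewrite !push_id.
by rewrite !push_step // IH rmorph1.
Qed.

Lemma pushZ i a (x : A i) : forall k, (i <= k)%N ->
  push (a *: x) k = a *: push x k.
Proof.
apply: leq_ind => [|k ik IH]; first by rewrite !push_id.
by rewrite !push_step // IH linearZ.
Qed.

Lemma push_phi i (x : A i) : forall k, (i < k)%N -> push (phi i x) k = push x k.
Proof.
apply: leq_ind => [|k ik IH]; first by rewrite push_id push_step // push_id.
by rewrite !push_step ?IH // ltnW.
Qed.

Definition push_germ i (x : A i) : germ A := germ_of (push x).

Lemma push_germ_semilinear i : semilinear (@push_germ i).
Proof.
split=> [a x|x y].
  by rewrite [RHS]germ_scaleE; apply/germ_ofP; exists i => k; exact: pushZ.
by rewrite [RHS]germ_addE; apply/germ_ofP; exists i => k; exact: pushD.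
Qed.

Lemma push_germ_monoid i : monoid_morphism (@push_germ i).
Proof.
split=> [|x y]; first by apply/germ_ofP; exists i; exact: push1.
by rewrite [RHS]germ_mulE; apply/germ_ofP; exists i => k; exact: pushM.
Qed.

HB.instance Definition _ i :=
  GRing.isSemilinear.Build F (A i) (germ A) *:%R (@push_germ i)
    (@push_germ_semilinear i).
HB.instance Definition _ i :=
  GRing.isMonoidMorphism.Build (A i) (germ A) (@push_germ i) (@push_germ_monoid i).

Variables (L : semiAlgType F) (u : forall i, {lrmorphism A i -> L}).
Hypothesis uL : direct_limit phi u.

Lemma cocone_push i (x : A i) : forall k, (i <= k)%N -> u k (push x k) = u i x.
Proof.
have [uphi _] := uL.
apply: leq_ind => [|k ik IH]; first by rewrite push_id.
by rewrite push_step // -[RHS]IH -(uphi k).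
Qed.

(** The germs of pushed elements form a cocone, so the universal map sends [u i x] to the germ of
    [push x]. *)
Lemma direct_limit_eq i (x y : A i) : u i x = u i y ->
  exists N, forall k, (N <= k)%N -> push x k = push y k.
Proof.
have [uphi univ] := uL.
have [|h hu _] := univ (germ A) (fun i => @push_germ i : {lrmorphism A i -> germ A}).
  by move=> j z; apply/germ_ofP; exists j.+1; exact: push_phi.
move=> /(congr1 h) xy; apply/germ_ofP.
exact: etrans (esym (hu i x)) (etrans xy (hu i y)).
Qed.

Definition stage_image (s : L) : bool := `[< exists i (x : A i), s = u i x >].

Lemma stage_image_common s t : stage_image s -> stage_image t ->
  exists k (x y : A k), s = u k x /\ t = u k y.
Proof.
move=> /asboolP [i [x ->]] /asboolP [j [y ->]].
exists (maxn i j), (push x (maxn i j)), (push y (maxn i j)).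
by rewrite !cocone_push ?leq_maxl ?leq_maxr.
Qed.

Lemma stage_image_closed : GRing.subsemialg_closed stage_image.
Proof.
split.
- by apply/asboolP; exists 0, 1; rewrite rmorph1.
- split=> [|s t sI tI].
    by apply/asboolP; exists 0, 0; rewrite rmorph0.
  have [k [x [y [-> ->]]]] := stage_image_common sI tI.
  by apply/asboolP; exists k, (x + y); rewrite rmorphD.
- move=> a s /asboolP [i [x ->]].
  by apply/asboolP; exists i, (a *: x); rewrite linearZ.
move=> s t sI tI; have [k [x [y [-> ->]]]] := stage_image_common sI tI.
by apply/asboolP; exists k, (x * y); rewrite rmorphM.
Qed.

HB.instance Definition _ :=
  GRing.isSubSemiAlgClosed.Build _ _ stage_image stage_image_closed.

Definition limit_image : Type := {s : L | stage_image s}.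

HB.instance Definition _ := SubType.on limit_image.
HB.instance Definition _ := [Choice of limit_image by <:].
HB.instance Definition _ := [SubChoice_isSubSemiAlgebra of limit_image by <:].

Definition to_image i (x : A i) : limit_image :=
  exist _ (u i x) (asboolT (ex_intro _ i (ex_intro _ x erefl))).

Lemma to_image_semilinear i : semilinear (@to_image i).
Proof.
by split=> [a x|x y]; apply: val_inj; rewrite /= ?linearZ ?raddfD.
Qed.

Lemma to_image_monoid i : monoid_morphism (@to_image i).
Proof.
by split=> [|x y]; apply: val_inj; rewrite /= ?rmorph1 ?rmorphM.
Qed.

HB.instance Definition _ i :=
  GRing.isSemilinear.Build F (A i) limit_image *:%R (@to_image i)
    (@to_image_semilinear i).
HB.instance Definition _ i :=
  GRing.isMonoidMorphism.Build (A i) limit_image (@to_image i)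
    (@to_image_monoid i).

(** The union of the images of the stages is a subalgebra receiving a cocone. The induced map into
    it, followed by the inclusion, is the identity by uniqueness. *)
Lemma direct_limit_cover s : exists i (x : A i), s = u i x.
Proof.
have [uphi univ] := uL.
have [|h hu _] :=
    univ limit_image (fun i => @to_image i : {lrmorphism A i -> limit_image}).
  by move=> i x; apply: val_inj; exact: uphi.
have [k _ kE] := univ L u uphi.
have valh_linear : semilinear (fun t => val (h t) : L).
  by split=> [a x|x y]; rewrite ?linearZ ?raddfD.
have valh_monoid : monoid_morphism (fun t => val (h t) : L).
  by split=> [|x y]; rewrite ?rmorph1 ?rmorphM.
pose hS := GRing.isSemilinear.Build F L L *:%R _ valh_linear.
pose hM := GRing.isMonoidMorphism.Build L L _ valh_monoid.
pose valh : {lrmorphism L -> L} := HB.pack (fun t => val (h t) : L) hS hM.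
have valhu i : valh \o u i =1 u i by move=> x; rewrite /= (hu i x : h (u i x) = _).
have -> : s = val (h s).
  by rewrite [LHS](kE (idfun : {lrmorphism L -> L})) // -(kE valh valhu).
by case: (h s) => t /= /asboolP.
Qed.

End DirectLimit.

(** * Matricial algebras *)

Section Matricial.
Variable F : comNzSemiRingType.
Hypothesis hF : semifield F.

(** [P] prescribes the span: the whole algebra, or the image of a stage of the limit. *)
Record unit_system (S : semiAlgType F) (P : S -> Prop) := UnitSystem {
  us_index : finType;
  us_block : us_index -> us_index;
  us_unit : us_index -> us_index -> S;
  us_blockK : forall p, us_block (us_block p) = us_block p;
  us_units : mxunits us_block us_unit;
  us_span : forall s, P s <-> in_span us_unit s }.

Lemma mxunits_matrix n :
  mxunits (fun=> ord0) (fun p q => delta_mx p q : 'M[F]_n.+1).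
Proof.
split=> [p q q' t||p].
- by rewrite [LHS]mul_delta_mx_cond eqxx andbT; case: eqP.
- by rewrite -mx1_sum_delta.
apply/eqP => /matrixP /(_ p p); rewrite !mxE eqxx /=.
by apply/eqP; exact: oner_neq0.
Qed.

Section Product.
Variables (A B : semiAlgType F) (I J : finType).
Variables (c : I -> I) (d : J -> J) (e : I -> I -> A) (a : J -> J -> B).

Definition prod_block (p : I + J) : I + J :=
  match p with inl i => inl (c i) | inr j => inr (d j) end.

Definition prod_unit (p q : I + J) : A * B :=
  match p, q with
  | inl i, inl i' => (e i i', 0)
  | inr j, inr j' => (0, a j j')
  | _, _ => (0, 0)
  end.

Lemma mxunits_prod :
  mxunits c e -> mxunits d a -> mxunits prod_block prod_unit.
Proof.
move=> [eM se e_neq0] [aM sa a_neq0].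
have inlE (i i' : I) : (inl i == inl i' :> I + J) = (i == i') by [].
have inrE (j j' : J) : (inr j == inr j' :> I + J) = (j == j') by [].
have pairP (z w : A * B) : z.1 = w.1 -> z.2 = w.2 -> z = w.
  by case: z w => [? ?] [? ?] /= -> ->.
split=> [p q q' t||].
- apply: pairP; move: p q q' t => [p|p] [q|q] [q'|q'] [t|t];
    rewrite /= ?(inlE, inrE) ?mulr0 ?mul0r ?andbF ?eM ?aM //; by case: ifP.
- rewrite big_sumType /=; apply: pairP.
    rewrite /= !raddf_sum /= se big1 ?addr0 //.
  by rewrite /= !raddf_sum /= sa big1 ?add0r.
case=> [i|j]; apply/eqP => /=; [case=> /eqP|case=> /eqP].
  by rewrite (negbTE (e_neq0 i)).
by rewrite (negbTE (a_neq0 j)).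
Qed.

Lemma in_span_prod x y : in_span e x -> in_span a y -> in_span prod_unit (x, y).
Proof.
move=> [l ->] [m ->].
exists (fun p q => match p, q with
  inl i, inl i' => l i i' | inr j, inr j' => m j j' | _, _ => 0 end).
have pairP (z w : A * B) : z.1 = w.1 -> z.2 = w.2 -> z = w.
  by case: z w => [? ?] [? ?] /= -> ->.
rewrite /comb big_sumType /=; apply: pairP => /=; rewrite !raddf_sum /=.
  rewrite [X in _ + X]big1 ?addr0 => [|j _]; last first.
    rewrite raddf_sum big1 // => -[i|j'] _ /=; exact: scaler0.
  apply: eq_bigr => i _; rewrite big_sumType /= !raddf_sum /=
    [X in _ + X]big1 ?addr0 // => j _.
  exact: scaler0.
rewrite [X in X + _]big1 ?add0r => [|i _]; last first.
  rewrite raddf_sum big1 // => -[i'|j] _ /=; exact: scaler0.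
apply: eq_bigr => j _; rewrite big_sumType /= !raddf_sum /=
  [X in X + _]big1 ?add0r // => i _.
exact: scaler0.
Qed.

End Product.

Lemma unit_system_matrix n : inhabited (@unit_system 'M[F]_n.+1 (fun=> True)).
Proof.
apply: inhabits (UnitSystem _ (mxunits_matrix n) _) => // s; split=> // _.
by exists s; exact: matrix_sum_delta.
Qed.

Lemma unit_system_prod n s :
  inhabited (@unit_system (matrix_prod F n s) (fun=> True)).
Proof.
elim: s n => [|m s IH] n; first exact: unit_system_matrix.
have [[I c e cK eU sp]] := unit_system_matrix n.
have [[J d a dK aU sp']] := IH m.
apply: inhabits (UnitSystem _ (mxunits_prod eU aU) _) => [[p|p]|[x y]] /=.
- by rewrite cK.
- by rewrite dK.
split=> // _; apply: in_span_prod; first exact/sp.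
exact/sp'.
Qed.

Lemma torsion_free_matrix n : torsion_free 'M[F]_n.+1.
Proof.
move=> l m x lm; have [->|nlm] := eqVneq l m; [by left | right].
apply/matrixP => i j; rewrite mxE.
have [//|/hF [y xy]] := eqVneq (x i j) 0.
case/eqP: nlm; move/matrixP/(_ i j): lm; rewrite !mxE => /(congr1 ( *%R^~ y)).
by rewrite -!mulrA xy !mulr1.
Qed.

Lemma torsion_free_prod n s : torsion_free (matrix_prod F n s).
Proof.
elim: s n => [|m s IH] n; first exact: torsion_free_matrix.
move=> l k [x y] [] /torsion_free_matrix [->|->]; first by left.
by move/IH => [->|->]; [left | right].
Qed.

Lemma torsion_free_matricial (A : semiAlgType F) : matricial A -> torsion_free A.
Proof.
move=> [n [s [f /bij_inj f_inj]]] l m x /(congr1 f); rewrite !linearZ /=.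
case/torsion_free_prod; first by left.
by right; apply: f_inj; rewrite raddf0.
Qed.

Lemma unit_system_matricial (A : semiAlgType F) :
  matricial A -> inhabited (@unit_system A (fun=> True)).
Proof.
move=> [n [s [f [g fK gK]]]].
have [[I c e cK [eM se e_neq0] sp]] := unit_system_prod n s.
have gU : mxunits c (fun p q => g (e p q)).
  split=> [p q q' t||p].
  - apply: (can_inj fK); rewrite rmorphM /= !gK eM; case: ifP; rewrite ?gK //.
    by rewrite raddf0.
  - apply: (can_inj fK); rewrite raddf_sum rmorph1 -se.
    by apply: eq_bigr => p _; rewrite /= gK.
  apply/eqP => /(congr1 f); rewrite gK raddf0; apply/eqP; exact: e_neq0.
apply: inhabits (UnitSystem cK gU _) => x; split=> // _.
have [l xl] := (sp (f x)).1 Logic.I; exists l; apply: (can_inj fK).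
rewrite xl raddf_sum; apply: eq_bigr => p _; rewrite /= raddf_sum.
by apply: eq_bigr => q _; rewrite /= linearZ /= gK.
Qed.

(* A unital morphism may kill some blocks; the indices of the others are kept. *)
Lemma unit_system_image (A S : semiAlgType F) (u : {lrmorphism A -> S}) :
  inhabited (@unit_system A (fun=> True)) ->
  inhabited (@unit_system S (fun s => exists x, s = u x)).
Proof.
move=> [[I c e cK eU sp]]; have [eM se _] := eU.
pose alive : {pred I} := fun p => u (e p p) != 0.
(* [e p p] factors through [e (c p) (c p)], so the representative of a surviving index survives. *)
have aliveC p : p \in alive -> c p \in alive.
  apply: contraNneq => cp0.
  have -> : e p p = e p (c p) * e (c p) (c p) * e (c p) p.
    by rewrite eM !eqxx cK eqxx /= eM !eqxx cK eqxx.
  by rewrite !rmorphM /= cp0 mulr0 mul0r.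
pose d (p : {p in alive}) : {p in alive} := exist _ (c (val p)) (aliveC _ (valP p)).
pose a (p q : {p in alive}) := u (e (val p) (val q)).
have dK p : d (d p) = d p by apply: val_inj => /=.
have sum_alive (G : I -> S) : (forall p, p \notin alive -> G p = 0) ->
    \sum_p G p = \sum_(p : {p in alive}) G (val p).
  move=> G0; rewrite (bigID alive) /= [X in _ + X]big1 // addr0.
  by rewrite big_sub.
have e0l p q : p \notin alive -> u (e p q) = 0.
  move=> /negPn/eqP p0; have -> : e p q = e p p * e p q by rewrite eM !eqxx.
  by rewrite rmorphM /= p0 mul0r.
have e0r p q : q \notin alive -> u (e p q) = 0.
  move=> /negPn/eqP q0; have [pq|/(mxunits_off eU) ->] := eqVneq (c p) (c q).
    have -> : e p q = e p q * e q q by rewrite eM pq !eqxx.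
    by rewrite rmorphM /= q0 mulr0.
  by rewrite raddf0.
have aU : mxunits d a.
  split=> [p q q' t||p]; last exact: valP p.
  - rewrite /a -rmorphM eM -!val_eqE /=; case: ifP => // _; exact: raddf0.
  rewrite -(sum_alive (fun p => u (e p p))) => [|p /e0l //].
  by rewrite -(rmorph1 u) -se raddf_sum.
apply: inhabits (UnitSystem dK aU _) => s; split=> [[x ->]|[l ->]].
  have [l ->] := (sp x).1 Logic.I.
  exists (fun p q => l (val p) (val q)).
  rewrite raddf_sum; under eq_bigr do rewrite raddf_sum.
  rewrite sum_alive => [|p np]; last first.
    by rewrite big1 // => q _; rewrite /= linearZ /= e0l // scaler0.
  apply: eq_bigr => p _; rewrite sum_alive => [|q nq]; last first.
    by rewrite /= linearZ /= e0r // scaler0.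
  by apply: eq_bigr => q _; rewrite /= linearZ.
exists (\sum_p \sum_q l p q *: e (val p) (val q)).
rewrite raddf_sum; apply: eq_bigr => p _; rewrite /= raddf_sum.
by apply: eq_bigr => q _; rewrite /= linearZ.
Qed.

(** An equality between two multiples of an element already holds at some finite stage, which is
    matricial. *)
Lemma torsion_free_ultramatricial (S : semiAlgType F) :
  ultramatricial S -> torsion_free S.
Proof.
move=> [A [phi [u [mA uS]]]] l m s lm.
have [i [x sx]] := direct_limit_cover uS s.
have [N xN] : exists N, forall k, (N <= k)%N ->
    push phi (l *: x) k = push phi (m *: x) k.
  by apply: (direct_limit_eq uS); rewrite !linearZ /= -sx.
have := xN (maxn i N) (leq_maxr _ _).
rewrite !pushZ ?leq_maxl // => /(torsion_free_matricial (mA _)) [|x0]; first by left.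
by right; rewrite sx -(cocone_push uS x (leq_maxl i N)) x0 raddf0.
Qed.

(** The filtration is by the images of the stages, nested because [u n] factors through [u n.+1]. *)
Lemma filtration_ultramatricial (S : semiAlgType F) :
  ultramatricial S -> inhabited (mx_filtration S).
Proof.
move=> [A [phi [u [mA uS]]]].
have E n : {U : unit_system (fun s => exists x, s = u n x) | True}.
  by apply: cid; have [U] := unit_system_image (u n) (unit_system_matricial (mA n));
    exists U.
pose U n := sval (E n).
apply: (inhabits (@MxFiltration _ S (fun n => us_index (U n))
  (fun n => @us_block _ _ (U n)) (fun n => @us_unit _ _ (U n)) _ _ _ _)).
- by move=> n p; exact: us_blockK.
- by move=> n; exact: us_units.
- move=> n s /(us_span (U n)) [x ->]; apply/(us_span (U n.+1)); exists (phi n x).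
  by rewrite -[LHS](uS.1 n).
move=> s; have [n [x sx]] := direct_limit_cover uS s; exists n.
by apply/(us_span (U n)); exists x.
Qed.

End Matricial.

(** * Restriction of scalars *)

Section RestrictScalars.
Variables (S T : pzSemiRingType) (g : {rmorphism T -> S}).

(** The underlying monoid is unchanged; keeping [g] in the type lets the action of [T] through [g]
    be attached to it. *)
Definition restrict (P : lSemiModType S^c) : Type := let _ := g in P.

Section Structure.
Variable P : lSemiModType S^c.

HB.instance Definition _ := GRing.Nmodule.on (restrict P).

Let scale (a : T^c) (v : restrict P) : restrict P := ((g a : S^c) *: (v : P)).

Let scaleA a b v : scale a (scale b v) = scale (a * b) v.
Proof. by rewrite /scale scalerA [g (a * b)]rmorphM. Qed.

Let scale0r v : scale 0 v = 0.
Proof. by rewrite /scale rmorph0 scale0r. Qed.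

Let scale1r : left_id 1 scale.
Proof. by move=> v; rewrite /scale rmorph1 scale1r. Qed.

Let scaleDr : right_distributive scale +%R.
Proof. by move=> a u v; rewrite /scale scalerDr. Qed.

Let scaleDl v : {morph scale^~ v : a b / a + b}.
Proof. by move=> a b; rewrite /scale rmorphD scalerDl. Qed.

HB.instance Definition _ := GRing.Nmodule_isLSemiModule.Build T^c (restrict P)
  scaleA scale0r scale1r scaleDr scaleDl.
End Structure.

Lemma restrict_scale (P : lSemiModType S^c) (a : T) (v : P) :
  (a : T^c) *: (v : restrict P) = ((g a : S^c) *: v : P).
Proof. by []. Qed.

Lemma restrict_iso (P Q : lSemiModType S^c) :
  mod_iso P Q -> mod_iso (restrict P) (restrict Q).
Proof.
case=> f fb; apply: (@semilinear_mod_iso _ (restrict P) (restrict Q) f) => //.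
by split=> [a x|x y]; [rewrite !restrict_scale; exact: linearZ | exact: raddfD].
Qed.

Lemma restrict_prod (P Q : lSemiModType S^c) :
  mod_iso (restrict (P * Q)%type) (restrict P * restrict Q)%type.
Proof.
apply: (@semilinear_mod_iso _ (restrict (P * Q)%type)
  (restrict P * restrict Q)%type (fun x => x)) => //.
by exists id.
Qed.

Variable f : {rmorphism S -> T}.
Hypotheses (fK : cancel f g) (gK : cancel g f).

Lemma restrict_row n : mod_iso (restrict 'rV[S^c]_n) 'rV[T^c]_n.
Proof.
apply: (@semilinear_mod_iso _ (restrict 'rV[S^c]_n) 'rV[T^c]_n
  (fun x => \row_i f (x ord0 i))).
  split=> [a x|x y]; apply/rowP => i; rewrite !mxE.
    by rewrite [LHS]rmorphM gK.
  exact: (rmorphD f (x ord0 i) (y ord0 i)).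
exists (fun y : 'rV[T^c]_n => \row_i g (y ord0 i)) => x; apply/rowP => i.
  by rewrite !mxE fK.
by rewrite !mxE gK.
Qed.

Lemma restrict_regular : mod_iso (restrict (S^c)^o) (T^c)^o.
Proof.
apply: (@semilinear_mod_iso _ (restrict (S^c)^o) (T^c)^o f); last by exists g.
by split=> [a x|x y]; [rewrite [LHS]rmorphM gK | exact: (rmorphD f x y)].
Qed.

Lemma restrict_fgsp_subproof (P : fgsp S) : fg_strongly_projective (restrict P).
Proof.
have [n [Q PQ]] := fgspP P; exists n, (restrict Q).
apply: mod_iso_trans (mod_iso_sym (restrict_prod _ _)) _.
exact: mod_iso_trans (restrict_iso PQ) (restrict_row n).
Qed.

Definition restrict_fgsp (P : fgsp S) : fgsp T := Fgsp (restrict_fgsp_subproof P).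

Definition restrict_SV (x : SV S) : SV T :=
  SV_class (restrict_fgsp (sval (cid (SV_classE x)))).

Lemma restrict_SVE P : restrict_SV (SV_class P) = SV_class (restrict_fgsp P).
Proof.
rewrite /restrict_SV; case: cid => Q /= /SV_classP PQ.
exact/SV_classP/restrict_iso/mod_iso_sym.
Qed.

Lemma restrict_SVD x y :
  restrict_SV (cm_add x y) = cm_add (restrict_SV x) (restrict_SV y).
Proof.
have [P ->] := SV_classE x; have [Q ->] := SV_classE y.
rewrite /= SV_addE !restrict_SVE SV_addE; exact/SV_classP/restrict_prod.
Qed.

Lemma restrict_SV0 : restrict_SV (cm_zero (SV S)) = cm_zero (SV T).
Proof. rewrite restrict_SVE; exact/SV_classP/restrict_row. Qed.

Lemma restrict_SV1 :
  restrict_SV (SV_class (fgsp_regular S)) = SV_class (fgsp_regular T).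
Proof. rewrite restrict_SVE; exact/SV_classP/restrict_regular. Qed.

End RestrictScalars.

Lemma restrict_SVK (S T : pzSemiRingType) (f : {rmorphism S -> T})
    (g : {rmorphism T -> S}) (fK : cancel f g) (gK : cancel g f) :
  cancel (restrict_SV fK gK) (restrict_SV gK fK).
Proof.
move=> x; have [P ->] := SV_classE x; rewrite !restrict_SVE; apply/SV_classP.
apply: (@semilinear_mod_iso _ (restrict f (restrict g P)) P (fun x => x)).
  by split=> // a v; rewrite !restrict_scale fK.
by exists id.
Qed.

(** Restriction of scalars along the inverse of [f] turns right [S]-semimodules into right
    [T]-semimodules, and restriction along [f] undoes it. *)
Lemma SV_pointed_iso_ring (S T : pzSemiRingType) (f : {rmorphism S -> T}) :
  bijective f -> SV_pointed_iso S T.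
Proof.
move=> [g fK gK].
have gD : nmod_morphism g.
  split=> [|x y]; apply: (can_inj fK); rewrite ?rmorph0 ?rmorphD !gK //.
have gM : monoid_morphism g.
  split=> [|x y]; apply: (can_inj fK); rewrite ?rmorph1 ?rmorphM !gK //.
pose gh : {rmorphism T -> S} := HB.pack g (GRing.isNmodMorphism.Build T S g gD)
  (GRing.isMonoidMorphism.Build T S g gM).
have fK' : cancel f gh := fK.
have gK' : cancel gh f := gK.
exists (restrict_SV fK' gK'); last exact: restrict_SV1.
split; last exact: restrict_SV0.
  by exists (restrict_SV gK' fK'); exact: restrict_SVK.
exact: restrict_SVD.
Qed.

Theorem theorem5p10 (F : comNzSemiRingType) (hF : semifield F)
    (S T : semiAlgType F) (hS : ultramatricial S) (hT : ultramatricial T) :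
  SV_pointed_iso S T <-> alg_iso S T.
Proof.
split=> [[f [[g fK gK] fD f0] f1]|[f fb]]; last exact: (SV_pointed_iso_ring fb).
have [E] := filtration_ultramatricial hS; have [D] := filtration_ultramatricial hT.
exact: (alg_iso_of_SV_iso hF (torsion_free_ultramatricial hF hS)
  (torsion_free_ultramatricial hF hT) fK gK fD f0 f1 E D).
Qed.
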